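(* Let $G$ be a finite digraph, $\mathbb{K}$ a commutative ring and $\ell\ge0$ an integer. Assume that for any vertices $x,y$ with $d(x,y)=\ell$ a shortest path $s_{x,y}$ from $x$ to $y$ has been chosen. Then the $\mathbb{K}$-module $$\mathrm{MH}_{2,\ell}(G)\cong\left(\frac{R}{JR+RJ}\right)_\ell$$ is isomorphic to a free submodule of $\mathbb{K}\cdot(\overline{\mathtt{P}}_\ell\setminus\overline{\mathtt{N}}_\ell)$ freely generated by the elements of the form: (1) $[s]-[s_{x,y}]$, where $s$ is a shortest path of length $\ell$ from $x$ to $y$ such that $[s]\neq[s_{x,y}]$ (one generator for each such class $[s]$); (2) $[p]$, where $[p]\in\overline{\mathtt{L}}_\ell\setminus\overline{\mathtt{N}}_\ell$. Moreover, this isomorphism is induced by the isomorphism $\left(\frac{\mathbb{K}G}{JR+RJ}\right)_\ell\cong\mathbb{K}\cdot(\overline{\mathtt{P}}_\ell\setminus\overline{\mathtt{N}}_\ell)$ that sends the class of a path $p$ of length $\ell$ to $[p]$ if $[p]\notin\overline{\mathtt{N}}_\ell$ and to $0$ if $[p]\in\overline{\mathtt{N}}_\ell$.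
   Context: A digraph $G$ consists of a set of vertices and a set of arrows, which are ordered pairs of distinct vertices. A path of length $n\ge 0$ is a tuple of vertices $p=(p_0,\dots,p_n)$ such that each $(p_i,p_{i+1})$ is an arrow; $d(x,y)$ is the infimum of lengths of paths from $x$ to $y$ ($\infty$ if there are none). A path $(p_0,\dots,p_n)$ is shortest if $d(p_0,p_n)=n$, and long otherwise. A subpath of $p$ is a path of the form $(p_i,p_{i+1},\dots,p_j)$. A long path is minimal if all its proper subpaths are shortest, and non-minimal otherwise. Two paths connect the same vertices if they have the same initial and the same terminal vertex. Magnitude homology: put $|x_0,\dots,x_n|=\sum_{i=0}^{n-1}d(x_i,x_{i+1})$. $\mathrm{MC}_{n,\ell}(G)$ is the free $\mathbb{K}$-module on tuples of vertices with $x_i\neq x_{i+1}$ and $|x_0,\dots,x_n|=\ell$; the differential is $\sum_{i=0}^n(-1)^i\partial_{n,i}$, where $\partial_{n,i}$ deletes $x_i$ if the resulting tuple still has norm $\ell$ and is $0$ otherwise. $\mathrm{MH}_{n,\ell}(G)=H_n(\mathrm{MC}_{\bullet,\ell}(G))$. The path algebra $\mathbb{K}G$ is the free $\mathbb{K}$-module on all paths (including those of length zero), with product given by concatenation when defined and zero otherwise, graded by length. $J$ is the ideal generated by paths of length $\geq1$; $R$ is the ideal generated by all differences of shortest paths connecting the same vertices and by all long paths. The subscript $\ell$ denotes the degree $\ell$ component. An equivalence relation $\sim$ on the set of paths is a congruence if $p\sim\tilde p$ implies that $p,\tilde p$ connect the same vertices and $qpq'\sim q\tilde pq'$ whenever the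 concatenations are defined. The $k$-short congruence is the minimal congruence such that any two shortest paths connecting the same two vertices at distance at most $k$ are equivalent. $\overline{\mathtt{P}}_\ell$ is the quotient of the set of all paths of length $\ell$ by the $(\ell-1)$-short congruence, and $[p]$ is the class of $p$. $\overline{\mathtt{L}}_\ell$ and $\overline{\mathtt{N}}_\ell$ denote the images in $\overline{\mathtt{P}}_\ell$ of the sets of long paths of length $\ell$ and of non-minimal long paths of length $\ell$, respectively. $\mathbb{K}\cdot X$ is the free $\mathbb{K}$-module on a set $X$. *)

(* Defs.v *)
From HB Require Import structures.
From mathcomp Require Import all_boot all_order all_algebra.
From mathcomp Require Import finmap.
From mathcomp.multinomials Require Import monalg.
From mathcomp Require Import boolp classical_sets constructive_ereal.

Set Implicit Arguments.
Unset Strict Implicit.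
Unset Printing Implicit Defensive.

Import Order.TTheory GRing.Theory Num.Theory.
Local Open Scope quotient_scope.
Local Open Scope ring_scope.

(** * Free modules *)

(* The module structure that [monalg] puts on [{malg K[X]}] requires 1 != 0
   in K; this alias carries one over an arbitrary commutative ring. *)
Definition freemod (K : comPzRingType) (X : choiceType) := {malg K[X]}.

Section FreeModule.
Variables (K : comPzRingType) (X : choiceType).
Implicit Types (a b c : K) (u v : freemod K X).

HB.instance Definition _ := GRing.Zmodule.on (freemod K X).

Definition fm_scale c u : freemod K X :=
  \sum_(x <- msupp u) << c * u@_x *g x >>.

Lemma fm_scaleE c u x : (fm_scale c u)@_x = c * u@_x.
Proof.
rewrite {2}[u]monalgE !raddf_sum mulr_sumr.
by apply/eq_bigr => i _ /=; rewrite !mcoeffU mulrnAr.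
Qed.

Lemma fm_scaleA a b u : fm_scale a (fm_scale b u) = fm_scale (a * b) u.
Proof. by apply/malgP => x; rewrite !fm_scaleE mulrA. Qed.

Lemma fm_scale1 : left_id 1 fm_scale.
Proof. by move=> u; apply/malgP => x; rewrite fm_scaleE mul1r. Qed.

Lemma fm_scaleDr : right_distributive fm_scale +%R.
Proof. by move=> c u v; apply/malgP => x; rewrite !(mcoeffD, fm_scaleE) mulrDr. Qed.

Lemma fm_scaleDl u : {morph fm_scale^~ u : a b / a + b}.
Proof. by move=> a b; apply/malgP => x; rewrite !(mcoeffD, fm_scaleE) mulrDl. Qed.

HB.instance Definition _ := GRing.Zmodule_isLmodule.Build K (freemod K X)
  fm_scaleA fm_scale1 fm_scaleDr fm_scaleDl.

Definition gen (x : X) : freemod K X := << 1 *g x >>.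

(* [None] stands for zero *)
Definition ogen (x : option X) : freemod K X := oapp gen 0 x.

(* the linear extension of a map defined on the basis *)
Definition lext (V : lmodType K) (f : X -> V) (u : freemod K X) : V :=
  \sum_(x <- msupp u) u@_x *: f x.

Lemma lextw (V : lmodType K) (f : X -> V) (u : freemod K X) (D : {fset X}) :
  (msupp u `<=` D)%fset -> lext f u = \sum_(x <- D) u@_x *: f x.
Proof.
move=> sD; rewrite /lext (big_fset_incl _ sD) //= => x _ xu.
by rewrite mcoeff_outdom ?scale0r.
Qed.

Lemma lext_is_linear (V : lmodType K) (f : X -> V) : linear (lext f).
Proof.
move=> a u v.
pose D := (msupp u `|` msupp v `|` msupp (a *: u + v : freemod K X))%fset.
have sD : (msupp (a *: u + v : freemod K X) `<=` D)%fset by rewrite fsubsetUr.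
have uD : (msupp u `<=` D)%fset by rewrite /D -fsetUA fsubsetUl.
have vD : (msupp v `<=` D)%fset.
  by rewrite /D fsetUAC fsubsetUr.
rewrite (lextw _ sD) (lextw _ uD) (lextw _ vD) scaler_sumr -big_split /=.
apply: eq_bigr => x _.
by rewrite mcoeffD [(a *: u)@_x]fm_scaleE scalerDl scalerA.
Qed.

HB.instance Definition _ (V : lmodType K) (f : X -> V) :=
  GRing.isLinear.Build K (freemod K X) V _ (lext f) (lext_is_linear f).

(* M is a free submodule, freely generated by the family (f x)_x *)
Definition freely_generated (V : lmodType K) (f : X -> V) (M : set V) : Prop :=
  injective (lext f) /\ M = range (lext f).

End FreeModule.

Arguments gen {K X} x.
Arguments ogen {K X} x.

(** * Submodules and quotients *)

Section Submodules.
Variables (K : pzRingType) (V : lmodType K).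

Definition fullS : {pred V} := xpredT.

Lemma fullS_closed : subsemimod_closed fullS.
Proof. by []. Qed.
HB.instance Definition _ := GRing.isSubmodClosed.Build K V fullS fullS_closed.

Section Two.
Variables U W : submodClosed V.

Definition capS : {pred V} := fun v => (v \in U) && (v \in W).

Lemma capS_closed : subsemimod_closed capS.
Proof.
split; first split.
- by apply/andP; rewrite !rpred0.
- by move=> u v /andP[? ?] /andP[? ?]; apply/andP; rewrite !rpredD.
- by move=> a u /andP[? ?]; apply/andP; rewrite !rpredZ.
Qed.
HB.instance Definition _ := GRing.isSubmodClosed.Build K V capS capS_closed.

Definition addS : {pred V} :=
  fun v => `[< exists u w, [/\ u \in U, w \in W & v = u + w] >].

Lemma addS_closed : subsemimod_closed addS.
Proof.
split; first split.
- by apply/asboolP; exists 0, 0; rewrite addr0 !rpred0.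
- move=> v v' /asboolP[u [w [uU wW ->]]] /asboolP[u' [w' [uU' wW' ->]]].
  by apply/asboolP; exists (u + u'), (w + w'); rewrite addrACA !rpredD.
- move=> a v /asboolP[u [w [uU wW ->]]].
  by apply/asboolP; exists (a *: u), (a *: w); rewrite scalerDr !rpredZ.
Qed.
HB.instance Definition _ := GRing.isSubmodClosed.Build K V addS addS_closed.

End Two.

Definition spanS (A : set V) : {pred V} :=
  fun v => `[< forall S : submodClosed V, (A `<=` [set` S])%classic -> v \in S >].

Lemma spanS_closed A : subsemimod_closed (spanS A).
Proof.
split; first split.
- by apply/asboolP => S _; rewrite rpred0.
- move=> u v /asboolP uA /asboolP vA; apply/asboolP => S AS.
  by rewrite rpredD ?uA ?vA.
- by move=> a u /asboolP uA; apply/asboolP => S AS; rewrite rpredZ ?uA.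
Qed.
HB.instance Definition _ A :=
  GRing.isSubmodClosed.Build K V (spanS A) (spanS_closed A).

Definition submodule (S : submodClosed V) := {v : V | v \in S}.
HB.instance Definition _ S := SubChoice.on (submodule S).
HB.instance Definition _ S := [SubChoice_isSubLmodule of submodule S by <:].

Definition zpred (S : submodClosed V) : {pred V} := fun v => v \in S.
Lemma zpred_closed S : zmod_closed (zpred S).
Proof. exact: (GRing.subsemimod_closedB (GRing.subsemimodClosedP S)). Qed.
HB.instance Definition _ S :=
  GRing.isZmodClosed.Build V (zpred S) (zpred_closed S).

Definition quotmod (S : submodClosed V) := Quotient.quot (zpred S).

End Submodules.

Arguments fullS {K} V.

Section QuotientModule.
Variables (K : pzRingType) (V : lmodType K) (S : submodClosed V).

HB.instance Definition _ := GRing.Zmodule.on (quotmod S).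
HB.instance Definition _ := EqQuotient.on (quotmod S).

Definition quot_scale (a : K) (x : quotmod S) : quotmod S :=
  \pi_(quotmod S) (a *: repr x).

Lemma quot_scale_pi a v :
  quot_scale a (\pi_(quotmod S) v) = \pi_(quotmod S) (a *: v).
Proof.
have vS : repr (\pi_(quotmod S) v) - v \in S.
  by rewrite -[_ \in S]/(_ \in zpred S) Quotient.idealrBE reprK.
rewrite /quot_scale; apply/eqP.
rewrite -(Quotient.idealrBE (zpred S)) -scalerBr.
exact: rpredZ.
Qed.

Lemma quot_addE v w :
  \pi_(quotmod S) (v + w) = \pi_(quotmod S) v + \pi_(quotmod S) w.
Proof. exact: (@pi_addr V _ _ _ _ (Quotient.quot (zpred S))). Qed.

Lemma quot_scaleA a b x :
  quot_scale a (quot_scale b x) = quot_scale (a * b) x.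
Proof. by rewrite -[x]reprK !quot_scale_pi scalerA reprK. Qed.

Lemma quot_scale1 : left_id 1 quot_scale.
Proof. by move=> x; rewrite -[x]reprK quot_scale_pi scale1r. Qed.

Lemma quot_scaleDr : right_distributive quot_scale +%R.
Proof.
move=> a x y; rewrite -[x]reprK -[y]reprK -quot_addE !quot_scale_pi.
by rewrite scalerDr quot_addE.
Qed.

Lemma quot_scaleDl x : {morph quot_scale^~ x : a b / a + b}.
Proof.
by move=> a b; rewrite -[x]reprK !quot_scale_pi scalerDl quot_addE.
Qed.

HB.instance Definition _ := GRing.Zmodule_isLmodule.Build K (quotmod S)
  quot_scaleA quot_scale1 quot_scaleDr quot_scaleDl.

End QuotientModule.

Section Subquotient.
Variables (K : pzRingType) (V : lmodType K) (Z B : submodClosed V).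

Definition restrS : {pred submodule Z} := fun v => val v \in B.

Lemma restrS_closed : subsemimod_closed restrS.
Proof.
split; first split.
- by rewrite unfold_in /restrS raddf0 rpred0.
- by move=> u v uB vB; rewrite unfold_in /restrS raddfD rpredD.
- by move=> a u uB; rewrite unfold_in /restrS linearZ rpredZ.
Qed.
HB.instance Definition _ :=
  GRing.isSubmodClosed.Build K (submodule Z) restrS restrS_closed.

(* Z / (B :&: Z), which is Z / B as soon as B is contained in Z *)
Definition subquot := quotmod restrS.
HB.instance Definition _ := GRing.Lmodule.on subquot.

Definition sqclass (v : V) (vZ : v \in Z) : subquot :=
  \pi_(quotmod restrS) (exist _ v vZ : submodule Z).

End Subquotient.

(** * Digraphs and paths *)

Record digraph := Digraph {
  vertex :> finType;
  arrow : rel vertex;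
  arrow_irr : irreflexive arrow
}.

Section Paths.
Variable G : digraph.

(* The pair (x, s) encodes the path whose list of vertices is x :: s. *)
Definition gpath := {p : G * seq G | path (@arrow G) p.1 p.2}.
HB.instance Definition _ := SubChoice.on gpath.

Implicit Types (p q r : gpath) (x y : G).

Definition src p : G := (val p).1.
Definition tgt p : G := last (val p).1 (val p).2.
Definition plen p : nat := size (val p).2.
Definition pverts p : seq G := (val p).1 :: (val p).2.

Definition connected_in x y (n : nat) : bool :=
  `[< exists p, [/\ src p = x, tgt p = y & plen p = n] >].

Definition enat (n : nat) : \bar int := (n%:Z)%:E.

Definition dist x y : \bar int :=
  if pselect (exists n, connected_in x y n) is left h
  then enat (ex_minn h) else +oo%E.

Definition shortest p : bool := dist (src p) (tgt p) == enat (plen p).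
Definition long p : bool := ~~ shortest p.

Definition subpath q p : bool := infix (pverts q) (pverts p).

Definition minimal p : Prop :=
  long p /\ forall q, subpath q p -> q != p -> shortest q.
Definition nonminimal p : Prop := long p /\ ~ minimal p.

Lemma pcat_path p q : tgt p = src q ->
  path (@arrow G) (src p) ((val p).2 ++ (val q).2).
Proof.
by move=> pq; rewrite cat_path (valP p) /= -/(tgt p) pq (valP q).
Qed.

(* concatenation, [None] when it is undefined *)
Definition pcat p q : option gpath :=
  if tgt p =P src q is ReflectT pq
  then Some (exist _ (src p, (val p).2 ++ (val q).2) (pcat_path pq))
  else None.

Definition pcat3 p q r : option gpath := obind (pcat^~ r) (pcat p q).

Definition parallel p q : Prop := src p = src q /\ tgt p = tgt q.

Record congruence (E : gpath -> gpath -> Prop) : Prop := Congruence {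
  cong_refl : forall p, E p p;
  cong_sym : forall p q, E p q -> E q p;
  cong_trans : forall p q r, E p q -> E q r -> E p r;
  cong_parallel : forall p q, E p q -> parallel p q;
  cong_cat : forall p p' q q' r r', E p p' ->
    pcat3 q p q' = Some r -> pcat3 q p' q' = Some r' -> E r r'
}.

(* k is an integer, not a natural number, so that k = l - 1 makes sense for
   l = 0. *)
Definition kshort (k : int) p q : Prop :=
  forall E, congruence E ->
    (forall s t, shortest s -> shortest t -> parallel s t ->
       (dist (src s) (tgt s) <= k%:E)%E -> E s t) ->
    E p q.

Lemma parallel_congruence : congruence parallel.
Proof.
split=> [p|p q []|p q r [e1 e2] [e3 e4]|p q|p p' q q' r r' _] //.
  by split; rewrite (e1, e2) (e3, e4).
rewrite /pcat3 /pcat.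
case: eqP => // qp /=; case: eqP => //= h [<-].
case: eqP => // qp' /=; case: eqP => //= h' [<-].
split=> //; rewrite /tgt /= !last_cat.
move: h h'; rewrite /tgt /= !last_cat => h h'.
by rewrite h h'.
Qed.

Lemma kshort_parallel k p q : kshort k p q -> parallel p q.
Proof. by move=> /(_ _ parallel_congruence); apply. Qed.

Section Length.
Variable l : nat.

Definition lpath := {p : gpath | plen p == l}.
HB.instance Definition _ := SubChoice.on lpath.

Definition Pequiv : rel lpath :=
  fun p q : lpath => `[< kshort (l%:Z - 1) (val p) (val q) >].

Lemma Pequiv_equiv : equiv_class_of Pequiv.
Proof.
split=> [p|p q|q p r].
- by apply/asboolP => E [].
- apply/asboolP/asboolP => h E cE sE;
    exact: (cong_sym cE (h E cE sE)).
- move=> /asboolP h1 /asboolP h2; apply/asboolP => E cE sE.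
  exact: (cong_trans cE (h1 E cE sE) (h2 E cE sE)).
Qed.

Canonical Pequiv_rel := EquivRelPack Pequiv_equiv.
Canonical Pequiv_encModRel := defaultEncModRel Pequiv.

Definition Pbar := {eq_quot Pequiv}.
HB.instance Definition _ : EqQuotient lpath Pequiv Pbar := EqQuotient.on Pbar.
HB.instance Definition _ := Choice.on Pbar.

Definition pclass (p : lpath) : Pbar := \pi_Pbar p.

Definition Lbar : {pred Pbar} :=
  fun c => `[< exists2 p : lpath, long (val p) & pclass p = c >].
Definition Nbar : {pred Pbar} :=
  fun c => `[< exists2 p : lpath, nonminimal (val p) & pclass p = c >].

Definition PNbar := {c : Pbar | c \notin Nbar}.
HB.instance Definition _ := SubChoice.on PNbar.

Definition csrc (c : Pbar) : G := src (val (repr c)).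
Definition ctgt (c : Pbar) : G := tgt (val (repr c)).

Lemma pclass_parallel (p : lpath) :
  csrc (pclass p) = src (val p) /\ ctgt (pclass p) = tgt (val p).
Proof.
have /eqP : \pi_Pbar (repr (pclass p)) = \pi_Pbar p by rewrite reprK.
by rewrite piE => /asboolP /kshort_parallel.
Qed.

End Length.

(** * The path algebra *)

Section PathAlgebra.
Variable K : comPzRingType.

Definition palg := freemod K gpath.
HB.instance Definition _ := GRing.Lmodule.on palg.

Definition pmul (a b : palg) : palg :=
  lext (fun p => lext (fun q => ogen (pcat p q) : palg) b) a.

Definition is_ideal (S : {pred palg}) : Prop :=
  forall a b, b \in S -> pmul a b \in S /\ pmul b a \in S.

Definition idealS (A : set palg) : {pred palg} :=
  fun v => `[< forall S : submodClosed palg,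
    is_ideal S -> (A `<=` [set` S])%classic -> v \in S >].

Lemma idealS_closed A : subsemimod_closed (idealS A).
Proof.
split; first split.
- by apply/asboolP => S _ _; rewrite rpred0.
- move=> u v /asboolP uA /asboolP vA; apply/asboolP => S iS AS.
  by rewrite rpredD ?uA ?vA.
- by move=> a u /asboolP uA; apply/asboolP => S iS AS; rewrite rpredZ ?uA.
Qed.
HB.instance Definition _ A :=
  GRing.isSubmodClosed.Build K palg (idealS A) (idealS_closed A).

Definition mulS (U W : submodClosed palg) : {pred palg} :=
  spanS [set v | exists a b, [/\ a \in U, b \in W & v = pmul a b]].
HB.instance Definition _ U W := GRing.SubmodClosed.on (mulS U W).

Definition Jideal : {pred palg} :=
  idealS [set v | exists2 p, (0 < plen p)%N & v = gen p].
HB.instance Definition _ := GRing.SubmodClosed.on Jideal.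

Definition Rideal : {pred palg} :=
  idealS ([set v | exists s t, [/\ shortest s, shortest t, parallel s t &
                                   v = gen s - gen t]] `|`
          [set v | exists2 p, long p & v = gen p])%classic.
HB.instance Definition _ := GRing.SubmodClosed.on Rideal.

Definition JRRJ : {pred palg} := addS (mulS Jideal Rideal) (mulS Rideal Jideal).
HB.instance Definition _ := GRing.SubmodClosed.on JRRJ.

Definition homog (l : nat) : {pred palg} :=
  fun a => all (fun p => plen p == l) (msupp a).

Lemma homogP l (a : palg) :
  reflect (forall p, plen p != l -> a@_p = 0) (a \in homog l).
Proof.
apply: (iffP allP) => [h p pl|h p].
  by apply: mcoeff_outdom; apply: contra pl => /h.
by rewrite -mcoeff_neq0; apply: contra_neqT => /h.
Qed.

Lemma homog_closed l : subsemimod_closed (homog l).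
Proof.
split; first split.
- by apply/homogP => p _; rewrite mcoeff0.
- move=> a b /homogP ha /homogP hb; apply/homogP => p pl.
  by rewrite mcoeffD ha // hb // addr0.
- move=> c a /homogP ha; apply/homogP => p pl.
  by rewrite [LHS]fm_scaleE ha // mulr0.
Qed.
HB.instance Definition _ l :=
  GRing.isSubmodClosed.Build K palg (homog l) (homog_closed l).

(* the degree l component of U / W, for homogeneous submodules W <= U *)
Definition gradquot (U W : submodClosed palg) (l : nat) :=
  subquot (capS U (homog l)) W.
HB.instance Definition _ U W l := GRing.Lmodule.on (gradquot U W l).

Definition palg_mod (l : nat) := gradquot (fullS palg) JRRJ l.
HB.instance Definition _ l := GRing.Lmodule.on (palg_mod l).

Definition Rideal_mod (l : nat) := gradquot Rideal JRRJ l.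
HB.instance Definition _ l := GRing.Lmodule.on (Rideal_mod l).

Lemma lpath_homog l (p : lpath l) :
  (gen (val p) : palg) \in capS (fullS palg) (homog l).
Proof.
apply/andP; split=> //; apply/homogP => q; rewrite mcoeffU.
by case: (val p =P q) => // <-; rewrite (eqP (valP p)) eqxx.
Qed.

Definition palg_mod_class l (p : lpath l) : palg_mod l :=
  sqclass JRRJ (lpath_homog p).

End PathAlgebra.

(** * Magnitude homology *)

Section Magnitude.
Variable K : comPzRingType.

(* [lift ord_max i] and [lift ord0 i] have values i and i.+1 *)
Definition norm n (x : n.+1.-tuple G) : \bar int :=
  (\sum_(i < n) dist (tnth x (lift ord_max i)) (tnth x (lift ord0 i)))%E.

Definition nondegenerate n (x : n.+1.-tuple G) : bool :=
  [forall i : 'I_n, tnth x (lift ord_max i) != tnth x (lift ord0 i)].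

Definition chain (n l : nat) :=
  {x : n.+1.-tuple G | nondegenerate x && (norm x == enat l)}.
HB.instance Definition _ n l := SubChoice.on (chain n l).

Definition MC n l := freemod K (chain n l).
HB.instance Definition _ n l := GRing.Lmodule.on (MC n l).

Definition del n (i : 'I_n.+2) (x : n.+2.-tuple G) : n.+1.-tuple G :=
  [tuple tnth x (lift i j) | j < n.+1].

(* Distinct vertices are at positive distance, so when deleting x_i preserves
   the norm the resulting tuple is nondegenerate: [insub] fails exactly when
   the norm changes. *)
Definition face n l (i : 'I_n.+2) (x : chain n.+1 l) : MC n l :=
  ogen (insub (del i (val x)) : option (chain n l)).

Definition boundary n l : MC n.+1 l -> MC n l :=
  lext (fun x : chain n.+1 l => \sum_(i < n.+2) (-1) ^+ i *: face i x).
HB.instance Definition _ n l := GRing.Linear.on (@boundary n l).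

Definition cycles n l : {pred MC n l} :=
  match n return {pred MC n l} with
  | 0 => xpredT
  | m.+1 => fun c => boundary c == 0
  end.

Lemma cycles_closed n l : subsemimod_closed (@cycles n l).
Proof.
case: n => [|n] //; split; first split.
- by rewrite unfold_in /= raddf0.
- by move=> u v /eqP hu /eqP hv; rewrite unfold_in /= raddfD /= hu hv addr0.
- by move=> a u /eqP hu; rewrite unfold_in /= linearZ /= hu scaler0.
Qed.
HB.instance Definition _ n l :=
  GRing.isSubmodClosed.Build K (MC n l) (@cycles n l) (@cycles_closed n l).

Definition boundaries n l : {pred MC n l} :=
  fun c => `[< exists b : MC n.+1 l, boundary b = c >].

Lemma boundaries_closed n l : subsemimod_closed (@boundaries n l).
Proof.
split; first split.
- by apply/asboolP; exists 0; rewrite raddf0.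
- move=> u v /asboolP[b <-] /asboolP[c <-].
  by apply/asboolP; exists (b + c); rewrite raddfD.
- move=> a u /asboolP[b <-].
  by apply/asboolP; exists (a *: b); rewrite linearZ.
Qed.
HB.instance Definition _ n l := GRing.isSubmodClosed.Build K (MC n l)
  (@boundaries n l) (@boundaries_closed n l).

Definition MH n l := subquot (@cycles n l) (@boundaries n l).
HB.instance Definition _ n l := GRing.Lmodule.on (MH n l).

End Magnitude.

(** * The generators *)

Section Generators.
Variables (K : comPzRingType) (l : nat).

(* the image of a class under K.Pbar -> K.(Pbar \ Nbar), which kills Nbar *)
Definition cgen (c : Pbar l) : freemod K (PNbar l) :=
  ogen (insub c : option (PNbar l)).

Variable s : forall x y, dist x y == enat l -> lpath l.

(* Equivalent paths are parallel, so these are the classes of the shortest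
   paths of length l. *)
Definition shclass := {c : Pbar l | dist (csrc c) (ctgt c) == enat l}.
HB.instance Definition _ := SubChoice.on shclass.

Definition chosen (c : shclass) : Pbar l := pclass (s (valP c)).

Definition index1 := {c : shclass | val c != chosen c}.
HB.instance Definition _ := SubChoice.on index1.

Definition index2 := {c : Pbar l | (c \in @Lbar l) && (c \notin @Nbar l)}.
HB.instance Definition _ := SubChoice.on index2.

Definition generator (i : index1 + index2) : freemod K (PNbar l) :=
  match i with
  | inl c => cgen (val (val c)) - cgen (chosen (val c))
  | inr c => cgen (val c)
  end.

End Generators.

End Paths.

Arguments generator {G} K {l} s i.
Arguments Jideal G K _ : clear implicits.
Arguments Rideal G K _ : clear implicits.
Arguments JRRJ G K _ : clear implicits.

(* Main.v *)
Require Import Defs.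
From HB Require Import structures.
From mathcomp Require Import all_boot all_order all_algebra.
From mathcomp Require Import finmap.
From mathcomp.multinomials Require Import monalg.
From mathcomp Require Import boolp classical_sets constructive_ereal.
From mathcomp Require Import zify.
Set Implicit Arguments.
Unset Strict Implicit.
Unset Printing Implicit Defensive.
Import Order.TTheory GRing.Theory Num.Theory.
Local Open Scope quotient_scope.
Local Open Scope ring_scope.

(** Let F be the free module on the classes of paths of length l that contain
    no non-minimal long path.  The proof identifies three modules with F or with
    one and the same submodule of F.

    In degree l, JR + RJ is spanned by the elements u b v, where b is one of the
    generators of R and u, v are paths not both of length zero.  When b is a
    difference s - t, both paths have length less than l, so dividing by u b v
    amounts to passing to classes of the (l-1)-short congruence; when b is a long
    path, u b v is a non-minimal long path.  Hence sending a path to its class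
    induces an isomorphism from the degree l part of KG/(JR+RJ) onto F
    ([classmap_JRRJ], [JRRJ_pclass], [JRRJ_Nbar], [palg_mod_to_classes]).

    Allowing u and v to be both of length zero gives R itself.  Every element
    of R_l is therefore sent into the kernel of the map [endmap] that records the
    endpoints of a shortest class and vanishes on the long ones.  Subtracting from
    each shortest class the chosen one with the same endpoints splits that kernel
    along the proposed generators, and each of these comes from R_l
    ([generator_coordK], [classmap_R_range]).

    On the homological side, a basis element (x, y, z) of MC_2 comes from a path P
    of length l cut at y into two nonempty shortest pieces.  The pieces are shorter
    than l, so the class of P depends on the triple only; this is [cutmap].
    Cutting P at two different vertices gives two triples whose difference is the
    boundary of the quadruple with both vertices, once a cut with a long piece
    counts as zero ([tri_cut]).  So, when l > 1, cutting anywhere is inverse to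
    [cutmap] modulo boundaries ([uncut_cutmap], [cutmap_uncut]), and F is also the
    quotient of MC_2 by the boundaries.  As the differential MC_2 -> MC_1 only
    sees the endpoints of P, it corresponds to [endmap] ([endmap_cutmap]), and
    MH_2 is the kernel of [endmap] as well.  For l <= 1 both MH_2 and
    the kernel of [endmap] are zero. *)

(** * Free modules, submodules and quotients *)

Section FreeModules.
Variables (K : comPzRingType) (X : choiceType).

Lemma lext_gen (V : lmodType K) (f : X -> V) x : lext f (gen x) = f x.
Proof.
have sx : (msupp (gen x : freemod K X) `<=` [fset x])%fset.
  apply/fsubsetP => y; rewrite -mcoeff_neq0 mcoeffU inE.
  by case: (eqVneq x y) => _; rewrite ?eqxx.
by rewrite (lextw _ sx) big_seq_fset1 mcoeffU eqxx scale1r.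
Qed.

Lemma lext_ogen (V : lmodType K) (f : X -> V) o : lext f (ogen o) = oapp f 0 o.
Proof. by case: o => [x|] /=; rewrite ?lext_gen ?linear0. Qed.

Lemma freemod_sum (u : freemod K X) : u = \sum_(x <- msupp u) u@_x *: gen x.
Proof.
rewrite {1}[u]monalgE; apply: eq_bigr => x _; apply/malgP => y.
by rewrite [RHS]fm_scaleE !mcoeffU; case: eqP => _; rewrite ?mulr1 ?mulr0.
Qed.

Lemma freemod_ext (V : lmodType K) (f g : {linear freemod K X -> V}) :
  (forall x, f (gen x) = g (gen x)) -> f =1 g.
Proof.
move=> fg u; rewrite [u]freemod_sum !linear_sum.
by apply: eq_bigr => x _; rewrite !linearZ /= fg.
Qed.

Lemma freemod_sub (V : lmodType K) (S : submodClosed V)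
    (f : {linear freemod K X -> V}) (u : freemod K X) :
  (forall x, x \in msupp u -> f (gen x) \in S) -> f u \in S.
Proof.
move=> fS; rewrite [u]freemod_sum linear_sum big_seq.
by apply: rpred_sum => x xu; rewrite linearZ rpredZ ?fS.
Qed.

End FreeModules.

Section Kernels.
Variables (K : pzRingType) (V W : lmodType K) (h : {linear V -> W}).

Definition kerS : {pred V} := fun v => h v == 0.

Lemma kerS_closed : subsemimod_closed kerS.
Proof.
split; first split.
- by rewrite unfold_in /kerS raddf0.
- by move=> u v /eqP hu /eqP hv; rewrite unfold_in /kerS raddfD /= hu hv addr0.
- by move=> a u /eqP hu; rewrite unfold_in /kerS linearZ /= hu scaler0.
Qed.
HB.instance Definition _ := GRing.isSubmodClosed.Build K V kerS kerS_closed.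

End Kernels.

Lemma submodB (K : pzRingType) (V : lmodType K) (S : submodClosed V) u v :
  u \in S -> v \in S -> u - v \in S.
Proof. exact: (zpred_closed S).2. Qed.

Lemma quot_eq (K : pzRingType) (V : lmodType K) (S : submodClosed V) v w :
  \pi_(quotmod S) v = \pi_(quotmod S) w <-> v - w \in S.
Proof.
rewrite -[_ \in S]/(_ \in zpred S) Quotient.idealrBE.
by split=> [->|/eqP].
Qed.

Section QuotientMaps.
Variables (K : pzRingType) (V W : lmodType K).

Variables (Z B : submodClosed V).

Lemma sqclass_eq v w (vZ : v \in Z) (wZ : w \in Z) :
  sqclass B vZ = sqclass B wZ <-> v - w \in B.
Proof.
by rewrite /sqclass quot_eq unfold_in /restrS raddfB.
Qed.

Lemma sqclass_surj (x : subquot Z B) : exists v (vZ : v \in Z), x = sqclass B vZ.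
Proof.
rewrite -[x]reprK; case: (repr x) => v vZ.
by exists v, vZ.
Qed.

Lemma sqclass_linear a v w (vZ : v \in Z) (wZ : w \in Z)
    (vwZ : a *: v + w \in Z) :
  sqclass B vwZ = a *: sqclass B vZ + sqclass B wZ.
Proof.
pose v' : submodule Z := exist _ v vZ; pose w' : submodule Z := exist _ w wZ.
have -> : a *: sqclass B vZ = \pi_(quotmod (@restrS _ _ Z B)) (a *: v').
  exact: quot_scale_pi.
rewrite /sqclass -/w' -quot_addE; congr (\pi_(_) _).
by apply: val_inj; rewrite [RHS]raddfD /=.
Qed.

(** All quotients below are reached through this factorization: a subquotient
    is embedded in V by a map on the ambient module that detects B inside Z. *)
Lemma subquot_lift (h : {linear V -> W}) :
    (forall v, v \in Z -> v \in B -> h v = 0) ->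
  exists f : {linear subquot Z B -> W},
    [/\ forall v (vZ : v \in Z), f (sqclass B vZ) = h v,
        range f = (h @` [set` Z])%classic &
        (forall v, v \in Z -> h v = 0 -> v \in B) -> injective f].
Proof.
move=> hB.
pose f (x : subquot Z B) : W := h (val (repr x)).
have fE v (vZ : v \in Z) : f (sqclass B vZ) = h v.
  apply/eqP; rewrite -subr_eq0 -raddfB; apply/eqP; apply: hB.
    by apply: submodB => //; apply: valP.
  have := reprK (sqclass B vZ); case: (repr _) => w wZ /=.
  by move/(sqclass_eq wZ vZ).
have f_lin : linear f.
  move=> a x y.
  have [v [vZ ->]] := sqclass_surj x; have [w [wZ ->]] := sqclass_surj y.
  have vwZ : a *: v + w \in Z by rewrite rpredD ?rpredZ.
  by rewrite -(sqclass_linear vZ wZ vwZ) !fE linearP.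
pose F := HB.pack_for {linear subquot Z B -> W} f
  (GRing.isLinear.Build K _ _ _ f f_lin).
exists F; split=> [//||Bh x y].
  apply/seteqP; split=> [_ [x _ <-]|_ [v vZ <-]].
    by have [v [vZ ->]] := sqclass_surj x; exists v => //; rewrite -(fE _ vZ).
  by exists (sqclass B vZ) => //; rewrite -(fE _ vZ).
have [v [vZ ->]] := sqclass_surj x; have [w [wZ ->]] := sqclass_surj y.
rewrite /= !fE => /eqP; rewrite -subr_eq0 -raddfB => /eqP hvw.
by apply/sqclass_eq/Bh => //; apply: submodB.
Qed.

End QuotientMaps.

Lemma iso_of_eq_range (K : pzRingType) (U V W : lmodType K)
    (g : {linear U -> W}) (h : {linear V -> W}) :
    injective g -> injective h -> range g = range h ->
  exists f : {linear U -> V}, bijective f.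
Proof.
move=> gI hI gh.
have ex x : exists y, h y = g x.
  have : range g (g x) by exists x.
  by rewrite gh => -[y _ <-]; exists y.
have ex' y : exists x, g x = h y.
  have : range h (h y) by exists y.
  by rewrite -gh => -[x _ <-]; exists x.
pose f x := sval (cid (ex x)).
have fE x : h (f x) = g x := svalP (cid (ex x)).
have f_lin : linear f by move=> a x y; apply: hI; rewrite linearP !fE linearP.
exists (HB.pack_for {linear U -> V} f (GRing.isLinear.Build K _ _ _ f f_lin)).
exists (fun y => sval (cid (ex' y))) => [x|y] /=.
  by apply: gI; rewrite (svalP (cid (ex' _))) fE.
by apply: hI; rewrite fE (svalP (cid (ex' _))).
Qed.

(** * Concatenation, distances and long paths *)

Section GraphPaths.
Variable G : digraph.
Implicit Types (p q r t u v : gpath G) (x y z : G).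

Definition trivial_path x : gpath G := exist _ (x, [::]) isT.

Lemma gpath_eq p q : src p = src q -> (val p).2 = (val q).2 -> p = q.
Proof.
move=> e1 e2; apply: val_inj; move: e1 e2; rewrite /src.
by case: (val p) (val q) => [? ?] [? ?] /= -> ->.
Qed.

Lemma plen0_eq p : plen p = 0%N -> p = trivial_path (src p).
Proof. by move/size0nil => e; apply: gpath_eq. Qed.

Lemma tgt_plen0 p : plen p = 0%N -> tgt p = src p.
Proof. by move=> p0; rewrite (plen0_eq p0). Qed.

Lemma pcatE p q r : pcat p q = Some r <->
  [/\ tgt p = src q, src r = src p & (val r).2 = (val p).2 ++ (val q).2].
Proof.
rewrite /pcat; case: eqP => [e|ne]; last by split=> // -[].
split=> [[<-] //|[_ e1 e2]]; congr Some; exact: gpath_eq.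
Qed.

Lemma pcat_ex p q : tgt p = src q -> exists r, pcat p q = Some r.
Proof. by move=> e; rewrite /pcat; case: eqP => // e'; eexists. Qed.

Lemma pcat_tgt_src p q r : pcat p q = Some r -> tgt p = src q.
Proof. by move/pcatE => []. Qed.

Lemma pcat_src p q r : pcat p q = Some r -> src r = src p.
Proof. by move/pcatE => []. Qed.

Lemma pcat_tgt p q r : pcat p q = Some r -> tgt r = tgt q.
Proof.
by move/pcatE => [e1 e2 e3]; 
  rewrite {1}/tgt e3 last_cat -/(src r) e2 -/(tgt p) e1.
Qed.

Lemma pcat_plen p q r : pcat p q = Some r -> plen r = (plen p + plen q)%N.
Proof. by move/pcatE => [_ _ e]; rewrite /plen e size_cat. Qed.

Lemma pcat_split r k : (k <= plen r)%N ->
  exists p q, pcat p q = Some r /\ plen p = k.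
Proof.
move=> kr; have := valP r; rewrite -(cat_take_drop k (val r).2) cat_path.
case/andP => h1 h2.
exists (exist _ ((val r).1, take k (val r).2) h1).
exists (exist _ (last (val r).1 (take k (val r).2), drop k (val r).2) h2).
split; first by apply/pcatE; split=> //=; rewrite cat_take_drop.
by rewrite /plen /= size_takel.
Qed.

Lemma pcat_vl x p :
  pcat (trivial_path x) p = if x == src p then Some p else None.
Proof.
case: eqP => [e|ne]; first by apply/pcatE.
by case E : (pcat _ _) => //; case: ne; apply: pcat_tgt_src E.
Qed.

Lemma pcat_vr x p :
  pcat p (trivial_path x) = if tgt p == x then Some p else None.
Proof.
case: eqP => [e|ne]; first by apply/pcatE; rewrite cats0.
by case E : (pcat _ _) => //; case: ne; apply: pcat_tgt_src E.
Qed.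

Lemma pcat_vsrc p : pcat (trivial_path (src p)) p = Some p.
Proof. by rewrite pcat_vl eqxx. Qed.

Lemma pcat_vtgt p : pcat p (trivial_path (tgt p)) = Some p.
Proof. by rewrite pcat_vr eqxx. Qed.

Lemma pcatA p q r :
  obind (pcat p) (pcat q r) = obind (fun t => pcat t r) (pcat p q).
Proof.
case E1 : (pcat q r) => [qr|] /=; case Ends : (pcat p q) => [pq|] //=.
- have [r1 h1] : exists r1, pcat p qr = Some r1.
    by apply: pcat_ex; rewrite (pcat_src E1) (pcat_tgt_src Ends).
  rewrite h1; apply/esym/pcatE.
  move: E1 Ends h1 => /pcatE [a1 a2 a3] Ends /pcatE [b1 b2 b3].
  move/pcatE: (Ends) => [c1 c2 c3].
  by rewrite (pcat_tgt Ends) a1 b2 c2 b3 c3 a3 catA.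
- case E : (pcat p qr) => [r1|//]; have := pcat_tgt_src E.
  by rewrite (pcat_src E1) => /pcat_ex [r2]; rewrite Ends.
- case E : (pcat pq r) => [r1|//]; have := pcat_tgt_src E.
  by rewrite (pcat_tgt Ends) => /pcat_ex [r2]; rewrite E1.
Qed.

Lemma pcat3E u p v r : pcat3 u p v = Some r ->
  exists up pv, [/\ pcat u p = Some up, pcat p v = Some pv,
    pcat up v = Some r & pcat u pv = Some r].
Proof.
rewrite /pcat3; case E : (pcat u p) => [up|//] /= h.
have := pcatA u p v; rewrite E /= h.
by case E' : (pcat p v) => [pv|//] /= h'; exists up, pv.
Qed.

Lemma pcat3_plen u p v r : pcat3 u p v = Some r ->
  plen r = (plen u + plen p + plen v)%N.
Proof.
by case/pcat3E => up [_ [/pcat_plen <- _ /pcat_plen <- _]].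
Qed.

Lemma pcat3_ex p q u v r : parallel p q -> pcat3 u p v = Some r ->
  exists r', pcat3 u q v = Some r'.
Proof.
move=> [e1 e2] /pcat3E [up [pv [h1 h2 h3 h4]]].
have [uq hq] : exists uq, pcat u q = Some uq.
  by apply: pcat_ex; rewrite -e1 (pcat_tgt_src h1).
have [r' hr'] : exists r', pcat uq v = Some r'.
  by apply: pcat_ex; rewrite (pcat_tgt hq) -e2 (pcat_tgt_src h2).
by exists r'; rewrite /pcat3 hq.
Qed.

(** Turns contiguous subsequences of vertices into concatenations.  The two
    sequences overlap in the end vertices of q, hence the [belast] and [rcons]
    in the proof. *)
Lemma subpath_pcat3 q p : subpath q p <-> exists u v, pcat3 u q v = Some p.
Proof.
split; last first.
  move=> [u [v /pcat3E [uq [_ [/pcatE [a1 a2 a3] _ /pcatE [b1 b2 b3] _]]]]].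
  apply/infixP; exists (belast (src u) (val u).2), (val v).2.
  rewrite /pverts -/(src p) -/(src q) -a1 b2 a2 b3 a3 -!cat_cons.
  by rewrite lastI -/(tgt u) cat_rcons -catA.
move=> /infixP [a [b e]].
pose x := head (src q) a; pose a' := behead (rcons a (src q)).
have ea : x :: a' = rcons a (src q) by rewrite /x /a'; case: (a).
have := valP p.
have ep : pverts p = x :: a' ++ (val q).2 ++ b.
  by rewrite e -cat_cons ea cat_rcons.
case: ep => ex ep; rewrite ex ep !cat_path.
have la : last x a' = src q by rewrite -(last_cons x) ea last_rcons.
rewrite la => /and3P [h1 _ h2].
pose u : gpath G := exist _ (x, a') h1.
pose v : gpath G := exist _ (tgt q, b) h2.
have [r hr] : exists r, pcat u q = Some r by apply: pcat_ex.
exists u, v; rewrite /pcat3 hr /=; apply/pcatE; rewrite (pcat_tgt hr); split=> //.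
  by rewrite (pcat_src hr).
by move/pcatE: hr => [_ _ ->]; rewrite ep catA.
Qed.

Lemma enat_inj : injective enat.
Proof. by move=> m n []. Qed.

Lemma distP x y n : dist x y = enat n <->
  (exists p, [/\ src p = x, tgt p = y & plen p = n]) /\
  forall p, src p = x -> tgt p = y -> (n <= plen p)%N.
Proof.
rewrite /dist; case: pselect => [h|nh]; last first.
  split=> // -[hp _]; case: nh; exists n; exact/asboolP.
case: ex_minnP => m /asboolP hm mmin; split=> [/enat_inj <-|[hn nmin]].
  by split=> // p e1 e2; apply: mmin; apply/asboolP; exists p.
congr enat; apply/eqP; rewrite eqn_leq mmin ?andTb; last exact/asboolP.
by case: hm => p [e1 e2 <-]; apply: nmin.
Qed.

Lemma dist_path_ex p :
  exists2 n, (n <= plen p)%N & dist (src p) (tgt p) = enat n.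
Proof.
rewrite /dist; case: pselect => [h|nh]; last first.
  by case: nh; exists (plen p); apply/asboolP; exists p.
exists (ex_minn h) => //; case: ex_minnP => m _; apply.
by apply/asboolP; exists p.
Qed.

Lemma shortestP p : reflect
  (forall q, src q = src p -> tgt q = tgt p -> (plen p <= plen q)%N)
  (shortest p).
Proof.
apply: (iffP eqP) => [/distP [_ //]|h]; apply/distP; split=> //.
by exists p.
Qed.

Lemma shortest_dist p : shortest p -> dist (src p) (tgt p) = enat (plen p).
Proof. by move/eqP. Qed.

Lemma dist_shortest x y n : dist x y = enat n ->
  exists p, [/\ src p = x, tgt p = y, plen p = n & shortest p].
Proof.
move=> d; case/distP: (d) => -[p [e1 e2 e3]] _; exists p; split=> //.
by rewrite /shortest e1 e2 e3 d.
Qed.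

Lemma dist_cases x y :
  dist x y = +oo%E \/ exists p, [/\ src p = x, tgt p = y & shortest p].
Proof.
have [[p [e1 e2]]|np] := pselect (exists p, src p = x /\ tgt p = y).
  right; have [n _] := dist_path_ex p; rewrite e1 e2.
  by move=> /dist_shortest [q [f1 f2 f3 f4]]; exists q.
left; rewrite /dist; case: pselect => // h; case: np.
by case: h => n /asboolP [p [e1 e2 _]]; exists p.
Qed.

Lemma shortest_plen p q : shortest p -> shortest q -> parallel p q ->
  plen p = plen q.
Proof.
move=> /shortestP hp /shortestP hq [e1 e2].
by apply/eqP; rewrite eqn_leq hp // hq.
Qed.

Lemma shortest_parallel p q : shortest p -> parallel p q -> plen p = plen q ->
  shortest q.
Proof. by rewrite /shortest => hp [<- <-] <-. Qed.

Lemma shortest_vertices p : shortest p -> (src p == tgt p) = (plen p == 0%N).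
Proof.
move=> /shortestP h; apply/eqP/eqP => [e|/tgt_plen0 -> //].
by apply/eqP; rewrite -leqn0; apply: (h (trivial_path (src p))); rewrite ?e.
Qed.

(** The only shorter path would have length zero, and an arrow has distinct
    ends. *)
Lemma shortest_plen1 p : (plen p <= 1)%N -> shortest p.
Proof.
move=> p1; apply/shortestP => q e1 e2.
case: (posnP (plen q)) => [q0|]; last exact: leq_trans.
have e : tgt p = src p by rewrite -e1 -e2 tgt_plen0.
move: p1 e; rewrite q0 /plen /tgt /src; have := valP p.
case: (val p) => a [|b [|//]] //= /andP [ab _] _ e.
by move: ab; rewrite e arrow_irr.
Qed.

Lemma plen1_eq p q :
  parallel p q -> plen p = plen q -> (plen p <= 1)%N -> p = q.
Proof.
move=> [e1 e2] e3 e4; apply: gpath_eq => //.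
move: e1 e2 e3 e4; rewrite /plen /src /tgt.
by case: (val p) (val q) => a [|b [|//]] [a' [|b' [|//]]] //= _ ->.
Qed.

(** A shortcut of one factor would give a shortcut of the concatenation. *)
Lemma shortest_pcat p q r : pcat p q = Some r -> shortest r ->
  shortest p /\ shortest q.
Proof.
move=> e /shortestP sr.
have lr := pcat_plen e; have es := pcat_src e; have et := pcat_tgt e.
have em := pcat_tgt_src e.
split; apply/shortestP => t t1 t2.
  have [r' e'] : exists r', pcat t q = Some r' by apply: pcat_ex; rewrite t2.
  have := sr r'; rewrite (pcat_src e') (pcat_tgt e') (pcat_plen e') lr.
  by rewrite leq_add2r; apply; rewrite ?es ?et ?t1.
have [r' e'] : exists r', pcat p t = Some r' by apply: pcat_ex; rewrite t1.
have := sr r'; rewrite (pcat_src e') (pcat_tgt e') (pcat_plen e') lr.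
by rewrite leq_add2l; apply; rewrite ?es ?et ?t2.
Qed.

Lemma shortest_subpath q p : subpath q p -> shortest p -> shortest q.
Proof.
move/subpath_pcat3 => [u [v /pcat3E [uq [_ [h1 _ h2 _]]]]] sp.
by case: (shortest_pcat h2 sp) => /(shortest_pcat h1) [].
Qed.

Lemma nonminimal_subpath q p :
  subpath q p -> long q -> (plen q < plen p)%N -> nonminimal p.
Proof.
move=> qp lq lqp; split.
  by apply: contra lq; apply: shortest_subpath.
move=> [_ h]; move: lq; rewrite /long h //.
by apply: contraTneq lqp => ->; rewrite ltnn.
Qed.

Lemma nonminimal_pcat u v p : pcat u v = Some p ->
  (long u /\ (0 < plen v)%N) \/ (long v /\ (0 < plen u)%N) -> nonminimal p.
Proof.
move=> e; have lp := pcat_plen e.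
case=> -[h1 h2].
  apply: (@nonminimal_subpath u) => //; last by rewrite lp; lia.
  by apply/subpath_pcat3; exists (trivial_path (src u)), v;
    rewrite /pcat3 pcat_vsrc.
apply: (@nonminimal_subpath v) => //; last by rewrite lp; lia.
apply/subpath_pcat3; exists u, (trivial_path (tgt v)).
by rewrite /pcat3 e /= -(pcat_tgt e) pcat_vtgt.
Qed.

(** A long proper subpath can be enlarged, still properly, to one that shares an
    end with p, and enlarging keeps it long. *)
Lemma nonminimal_ex p : nonminimal p -> exists u v, pcat u v = Some p /\
  ((long u /\ (0 < plen v)%N) \/ (long v /\ (0 < plen u)%N)).
Proof.
move=> [lp nm].
have [q [qp nqp lq]] : exists q, [/\ subpath q p, q != p & long q].
  apply: contrapT => h; apply: nm; split=> // q qp nqp.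
  by apply: contrapT => /negP lq; apply: h; exists q.
case/subpath_pcat3: qp => u [v /pcat3E [uq [qv [h1 h2 h3 h4]]]].
case: (posnP (plen v)) => [v0|v0].
  exists u, qv; split=> //; right; split.
    by apply: contra lq => /(shortest_pcat h2) [].
  case: (posnP (plen u)) => // u0; case/eqP: nqp.
  move: h1 h3; rewrite (plen0_eq u0) (plen0_eq v0) pcat_vl pcat_vr.
  by case: ifP => // _ [<-]; case: ifP => // _ [<-].
exists uq, v; split=> //; left; split=> //.
by apply: contra lq => /(shortest_pcat h1) [].
Qed.

End GraphPaths.

(** * Classes of the short congruence *)

Section Congruence.
Variable G : digraph.
Implicit Types (p q r s t u v : gpath G).

Lemma dist_le_plen s (k : nat) : shortest s ->
  (dist (src s) (tgt s) <= (k%:Z - 1)%:E)%E = (plen s < k)%N.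
Proof. by move=> /shortest_dist ->; rewrite lee_fin; lia. Qed.

Section Classes.
Variable l : nat.

Lemma pclass_eqP (p q : lpath G l) :
  pclass p = pclass q <-> kshort (l%:Z - 1) (val p) (val q).
Proof. by split=> [/eqP|h]; [|apply/eqP]; rewrite piE => *; apply/asboolP. Qed.

(** The bound on the length of s is what makes the replacement a move of the
    (l-1)-short congruence. *)
Lemma pclass_subst s t u v (p q : lpath G l) :
    shortest s -> shortest t -> parallel s t -> (plen s < l)%N ->
    pcat3 u s v = Some (val p) -> pcat3 u t v = Some (val q) ->
  pclass p = pclass q.
Proof.
move=> ss st pst sl hp hq; apply/pclass_eqP => E cE sE.
by apply: (cong_cat cE _ hp hq); apply: sE => //; rewrite dist_le_plen.
Qed.

(** Induction principle for the short congruence.  Having the same value of h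
    inside every context is a congruence, and so contains the short congruence
    as soon as h does not distinguish its generating moves. *)
Lemma pclass_ind T (h : gpath G -> T) :
    (forall s t u v r r', shortest s -> shortest t -> parallel s t ->
       plen s = plen t -> (plen s < l)%N -> plen r = l -> plen r' = l ->
       pcat3 u s v = Some r -> pcat3 u t v = Some r' -> h r = h r') ->
  forall p q : lpath G l, pclass p = pclass q -> h (val p) = h (val q).
Proof.
move=> hh [p pl] [q ql] /pclass_eqP /= pq.
(* h is only controlled on paths of length l, so other lengths are erased *)
pose g r := if plen r == l then Some (h r) else None.
suff : g p = g q by rewrite /g pl ql => -[].
pose E a b := parallel a b /\ forall u v r r',
  pcat3 u a v = Some r -> pcat3 u b v = Some r' -> g r = g r'.
have cE : congruence E.
  split=> [a|a b [ab hab]|a b c [ab hab] [bc hbc]|a b []//|].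
  - by split=> // u v r r' -> [->].
  - split; first by rewrite /parallel; case: ab => -> ->.
    by move=> u v r r' h1 h2; apply/esym; apply: hab h2 h1.
  - split; first by rewrite /parallel; case: ab => -> ->.
    move=> u v r r' h1 h2; have [r1 h3] := pcat3_ex ab h1.
    by rewrite (hab _ _ _ _ h1 h3); apply: hbc h3 h2.
  - move=> a a' b b' r r' [aa' haa'] h1 h2; split.
      exact: (cong_cat (parallel_congruence G) aa' h1 h2).
    (* the factors around x' = y x w are absorbed into those around x *)
    have ext (x x' y w w' z : gpath G) :
        pcat3 y x w = Some x' -> pcat3 z x' w' <> None ->
        forall zy ww', pcat z y = Some zy -> pcat w w' = Some ww' ->
        pcat3 zy x ww' = pcat3 z x' w'.
      move=> /pcat3E [yx [xw [e1 e2 e3 e4]]] nz zy ww' e5 e6.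
      move: (pcatA z y x); rewrite e1 e5 /= => e7.
      move: (pcatA z yx w); rewrite e3 /= => e8.
      rewrite /pcat3 -e7 /= {}e8.
      case: (pcat z yx) => [zyx|//] /=.
      by move: (pcatA zyx w w'); rewrite e6 /= => ->.
    move=> u v x x' h3 h4.
    have [ur [rv [f1 f2 _ _]]] := pcat3E h3.
    have [ba [ab' [g1 g2 g3 g4]]] := pcat3E h1.
    have [ub hub] : exists ub, pcat u b = Some ub.
      by apply: pcat_ex; rewrite (pcat_tgt_src f1) (pcat_src g4).
    have [bv hbv] : exists bv, pcat b' v = Some bv.
      by apply: pcat_ex; rewrite -(pcat_tgt_src f2) (pcat_tgt g3).
    apply: (haa' ub bv).
      by rewrite (ext _ _ _ _ _ _ h1 _ _ _ hub hbv) ?h3.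
    by rewrite (ext _ _ _ _ _ _ h2 _ _ _ hub hbv) ?h4.
have [_ hE] : E p q.
  apply: pq => // a b sa sb ab; rewrite dist_le_plen // => la.
  split=> // u v r r' h1 h2; rewrite /g.
  have lab := shortest_plen sa sb ab.
  have e : plen r = plen r' by rewrite (pcat3_plen h1) (pcat3_plen h2) lab.
  rewrite -e; case: eqP => // lr; congr Some.
  by apply: (hh a b u v) => //; rewrite -e.
have [e1 e2] := kshort_parallel pq.
apply: (hE (trivial_path (src p)) (trivial_path (tgt p))); rewrite /pcat3.
  by rewrite pcat_vsrc /= pcat_vtgt.
by rewrite e1 e2 pcat_vsrc /= pcat_vtgt.
Qed.

Lemma lpath_len (p : lpath G l) : plen (val p) = l.
Proof. exact/eqP/(valP p). Qed.

Lemma pclass_eq_parallel (p q : lpath G l) :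
  pclass p = pclass q -> parallel (val p) (val q).
Proof. by move/pclass_eqP/kshort_parallel. Qed.

Lemma pclass_long (p q : lpath G l) :
  pclass p = pclass q -> long (val p) = long (val q).
Proof.
by move/pclass_eq_parallel => [e1 e2]; rewrite /long /shortest e1 e2 !lpath_len.
Qed.

Lemma NbarP (p : lpath G l) : pclass p \in @Nbar G l <->
  exists2 q : lpath G l, nonminimal (val q) & pclass q = pclass p.
Proof. by split=> [/asboolP //|h]; apply/asboolP. Qed.

Lemma Nbar_long (p : lpath G l) : pclass p \in @Nbar G l -> long (val p).
Proof. by move/NbarP => [q [lq _] /pclass_long <-]. Qed.

Lemma Nbar_pcat u v (p : lpath G l) : pcat u v = Some (val p) ->
    (long u /\ (0 < plen v)%N) \/ (long v /\ (0 < plen u)%N) ->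
  pclass p \in @Nbar G l.
Proof.
by move=> e h; apply/NbarP; exists p => //; apply: nonminimal_pcat e h.
Qed.

Lemma pclass_repr (c : Pbar G l) : pclass (repr c) = c.
Proof. exact: reprK. Qed.

Lemma pclass_repr_val (p : lpath G l) : pclass (repr (pclass p)) = pclass p.
Proof. exact: reprK. Qed.

End Classes.
End Congruence.

(** * The ideal R and the submodule JR + RJ *)

Section Algebra.
Variables (G : digraph) (K : comPzRingType).
Local Notation palg := (palg G K).
Implicit Types (p q r s t u v : gpath G) (a b c : palg).

Lemma pmul_genl p b : pmul (gen p) b = lext (fun q => ogen (pcat p q) : palg) b.
Proof. exact: lext_gen. Qed.

Lemma pmul_genr a q : pmul a (gen q) = lext (fun p => ogen (pcat p q) : palg) a.
Proof.
rewrite /pmul; congr (lext _ a); apply/funext => p.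
exact: lext_gen.
Qed.

Lemma pmul_gen p q : pmul (gen p) (gen q) = ogen (pcat p q) :> palg.
Proof. by rewrite pmul_genl lext_gen. Qed.

Lemma pmul_is_linear a : linear (pmul a).
Proof.
move=> k b c; rewrite /pmul /lext scaler_sumr -big_split /=.
apply: eq_bigr => p _.
by rewrite -!/(lext _ _) linearP scalerDr !scalerA mulrC.
Qed.
HB.instance Definition _ a :=
  GRing.isLinear.Build K palg palg _ (pmul a) (pmul_is_linear a).

Lemma pmulBl a b c : pmul (a - b) c = pmul a c - pmul b c.
Proof. exact: (linearB (lext _)). Qed.

Lemma pmul_Some p q r :
  pcat p q = Some r -> pmul (gen p) (gen q) = gen r :> palg.
Proof. by rewrite pmul_gen => ->. Qed.

Lemma pmul_subl (V : lmodType K) (f : {linear palg -> V}) a b :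
  (forall p, p \in msupp a -> f (pmul (gen p) b) = 0) -> f (pmul a b) = 0.
Proof.
move=> h; apply/eqP.
pose g : {linear palg -> palg} :=
  lext (fun p => lext (fun q => ogen (pcat p q) : palg) b).
apply: (freemod_sub (S := kerS f) (f := g)) => p pa.
rewrite [g _](_ : _ = pmul (gen p) b); last by rewrite /g /= lext_gen pmul_genl.
by apply/eqP/h.
Qed.

Lemma pmul_subr (V : lmodType K) (f : {linear palg -> V}) a b :
  (forall p, p \in msupp b -> f (pmul a (gen p)) = 0) -> f (pmul a b) = 0.
Proof.
move=> h; apply/eqP.
by apply: (freemod_sub (S := kerS f) (f := pmul a)) => p pb; apply/eqP/h.
Qed.

(** [None] acts as an adjoined unit, so that b, its one-sided multiples and its
    two-sided multiples are treated uniformly although no single path need be a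
    unit of the path algebra. *)
Definition omull (o : option (gpath G)) p :=
  if o is Some q then pcat q p else Some p.
Definition omulr p (o : option (gpath G)) :=
  if o is Some q then pcat p q else Some p.
Definition act o o' p := obind (fun t => omulr t o') (omull o p).
Definition olen o := oapp (@plen G) 0%N o.

Lemma act_mull o o' r p :
  obind (act o o') (pcat r p) = obind (fun t => act (Some t) o' p) (omull o r).
Proof.
case: o => [q|] //=; move: (pcatA q r p).
case: (pcat r p) => [rp|] /=; rewrite /act /=; last first.
  by case: (pcat q r) => [qr|] //= <-.
by move=> ->; case: (pcat q r).
Qed.

Lemma act_mulr o o' p r :
  obind (act o o') (pcat p r) = obind (fun t => act o (Some t) p) (omulr r o').
Proof.
rewrite /act; case: o => [q|] /=.
  move: (pcatA q p r); case: (pcat p r) => [pr|] /=.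
    move=> ->; case: (pcat q p) => [qp|] /=; last by case: (omulr r o').
    case: o' => [q'|] /=; last by case: (pcat qp r).
    by rewrite -pcatA; case: (pcat r q').
  case: (pcat q p) => [qp|] /=; last by case: (omulr r o').
  case: o' => [q'|] /= => [h|<- //].
  by move: (pcatA qp r q'); rewrite -h /=; case: (pcat r q').
case: o' => [q'|] /=; last by case: (pcat p r).
by rewrite -pcatA; case: (pcat r q').
Qed.

(** A missing factor can be replaced by a trivial path, and the same choice
    serves all paths parallel to s. *)
Lemma act_pcat3 o o' s : exists u v, [/\ plen u = olen o, plen v = olen o' &
  forall t, parallel s t -> act o o' t = pcat3 u t v].
Proof.
exists (odflt (trivial_path (src s)) o), (odflt (trivial_path (tgt s)) o').
split; [by case: o|by case: o'|move=> t [e1 e2]].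
rewrite /act /pcat3; case: o => [q|] /=; last first.
  by rewrite e1 pcat_vsrc; case: o' => //=; rewrite e2 pcat_vtgt.
case E : (pcat q t) => [qt|] //=; case: o' => //=.
by rewrite e2 -(pcat_tgt E) pcat_vtgt.
Qed.

Section Annihilator.
Variables (V : lmodType K) (d : nat) (psi : gpath G -> V).

Definition sandwich o o' : palg -> V := lext (fun p => oapp psi 0 (act o o' p)).
HB.instance Definition _ o o' := GRing.Linear.on (sandwich o o').

Lemma sandwich_gen o o' p :
  sandwich o o' (gen p) = oapp psi 0 (act o o' p).
Proof. exact: lext_gen. Qed.

(** The elements all of whose multiples by factors of total length at least d
    are killed by psi.  Multiplying makes the factors longer, so this is an ideal
    for every d; d = 0 is used for R and d = 1 for JR + RJ. *)
Definition annS : {pred palg} := fun b =>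
  `[< forall o o', (d <= olen o + olen o')%N -> sandwich o o' b = 0 >].

Lemma annS_closed : subsemimod_closed annS.
Proof.
split; first split.
- by apply/asboolP => o o' _; rewrite raddf0.
- move=> a b /asboolP ha /asboolP hb; apply/asboolP => o o' h.
  by rewrite raddfD /= ha // hb // addr0.
- move=> k a /asboolP ha; apply/asboolP => o o' h.
  by rewrite linearZ /= ha // scaler0.
Qed.
HB.instance Definition _ := GRing.isSubmodClosed.Build K palg annS annS_closed.

Lemma sandwich_mull o o' r b : sandwich o o' (pmul (gen r) b) =
  oapp (fun t => sandwich (Some t) o' b) 0 (omull o r).
Proof.
rewrite pmul_genl.
pose f := lext (fun q => ogen (pcat r q) : palg).
have e p : sandwich o o' (f (gen p)) =
    oapp psi 0 (obind (fun t => act (Some t) o' p) (omull o r)).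
  by rewrite /f lext_gen /sandwich lext_ogen -act_mull; case: (pcat r p).
case E : (omull o r) => [t|] /=; rewrite -/(f b).
  have := @freemod_ext _ _ _ (sandwich o o' \o f) (sandwich (Some t) o').
  by apply=> p /=; rewrite e E /= sandwich_gen.
have := @freemod_ext _ _ _ (sandwich o o' \o f) (\0).
by apply=> p /=; rewrite e E.
Qed.

Lemma sandwich_mulr o o' r b : sandwich o o' (pmul b (gen r)) =
  oapp (fun t => sandwich o (Some t) b) 0 (omulr r o').
Proof.
rewrite pmul_genr.
pose f := lext (fun q => ogen (pcat q r) : palg).
have e p : sandwich o o' (f (gen p)) =
    oapp psi 0 (obind (fun t => act o (Some t) p) (omulr r o')).
  by rewrite /f lext_gen /sandwich lext_ogen -act_mulr; case: (pcat p r).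
case E : (omulr r o') => [t|] /=; rewrite -/(f b).
  have := @freemod_ext _ _ _ (sandwich o o' \o f) (sandwich o (Some t)).
  by apply=> p /=; rewrite e E /= sandwich_gen.
have := @freemod_ext _ _ _ (sandwich o o' \o f) (\0).
by apply=> p /=; rewrite e E.
Qed.

Lemma annS_ideal : is_ideal annS.
Proof.
move=> a b /asboolP hb; split; apply/asboolP => o o' h.
  apply: pmul_subl => p _; rewrite /= sandwich_mull.
  case E : (omull o p) => [t|] //=; apply: hb; apply: leq_trans h _.
  rewrite leq_add2r /=; case: o E => [q|] //= /pcat_plen ->.
  exact: leq_addr.
apply: pmul_subr => p _; rewrite /= sandwich_mulr.
case E : (omulr p o') => [t|] //=; apply: hb; apply: leq_trans h _.
rewrite leq_add2l /=; case: o' E => [q|] //= /pcat_plen ->.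
exact: leq_addl.
Qed.

(** To bound R from above it suffices to test psi on multiples of the
    generators, since [annS] is an ideal. *)
Lemma Rideal_ann b :
    (forall u s t v r r', (d <= plen u + plen v)%N ->
       shortest s -> shortest t -> parallel s t -> plen s = plen t ->
       pcat3 u s v = Some r -> pcat3 u t v = Some r' -> psi r = psi r') ->
    (forall u p v r, (d <= plen u + plen v)%N -> long p ->
       pcat3 u p v = Some r -> psi r = 0) ->
  b \in Rideal G K ->
  forall o o', (d <= olen o + olen o')%N -> sandwich o o' b = 0.
Proof.
move=> h1 h2 /asboolP hb; apply/asboolP/(hb annS); first exact: annS_ideal.
move=> _ [[s [t [ss st pst ->]]]|[p lp ->]]; apply/asboolP => o o' h.
  apply/eqP; rewrite raddfB subr_eq0 /=; apply/eqP.
  rewrite [LHS]sandwich_gen [RHS]sandwich_gen.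
  have [u [v [lu lv e]]] := act_pcat3 o o' s.
  rewrite -lu -lv in h; rewrite (e s) // (e t) //.
  case E : (pcat3 u s v) => [r|]; last first.
    case E' : (pcat3 u t v) => [r|] //.
    have pts : parallel t s by case: pst.
    by have [r'] := pcat3_ex pts E'; rewrite E.
  have [r' E'] := pcat3_ex pst E; rewrite E' /=.
  by apply: (h1 u s t v r r') => //; apply: shortest_plen.
rewrite sandwich_gen; have [u [v [lu lv ->]]] := act_pcat3 o o' p; last by [].
rewrite -lu -lv in h; case E : (pcat3 u p v) => [r|] //=.
exact: h2 E.
Qed.

End Annihilator.

(** Parallel paths of equal length are both shortest or both long. *)
Lemma Rideal_parallel p q :
  parallel p q -> plen p = plen q -> gen p - gen q \in Rideal G K.
Proof.
move=> pq epq; have [sp|lp] := boolP (shortest p).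
  have sq := shortest_parallel sp pq epq.
  by apply/asboolP => S _ AS; apply: AS; left; exists p, q.
have lq : long q by rewrite /long /shortest -epq; case: pq => <- <-.
by apply: submodB; apply/asboolP => S _ AS; apply: AS; right;
  [exists p|exists q].
Qed.

Lemma Rideal_long p : long p -> gen p \in Rideal G K.
Proof. by move=> lp; apply/asboolP => S _ AS; apply: AS; right; exists p. Qed.

Lemma Jideal_gen p : (0 < plen p)%N -> gen p \in Jideal G K.
Proof. by move=> lp; apply/asboolP => S _ AS; apply: AS; exists p. Qed.

Lemma JRRJ_l p b : (0 < plen p)%N ->
  b \in Rideal G K -> pmul (gen p) b \in JRRJ G K.
Proof.
move=> p0 bR; apply/asboolP; exists (pmul (gen p) b), 0; rewrite rpred0 addr0.
split=> //; apply/asboolP => S AS; apply: AS; exists (gen p), b.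
by split=> //; apply: Jideal_gen.
Qed.

Lemma JRRJ_r p b : (0 < plen p)%N ->
  b \in Rideal G K -> pmul b (gen p) \in JRRJ G K.
Proof.
move=> p0 bR; apply/asboolP; exists 0, (pmul b (gen p)); rewrite rpred0 add0r.
split=> //; apply/asboolP => S AS; apply: AS; exists b, (gen p).
by split=> //; apply: Jideal_gen.
Qed.

Lemma JRRJ_nonminimal p : nonminimal p -> gen p \in JRRJ G K.
Proof.
case/nonminimal_ex => u [v [e]].
have -> : gen p = pmul (gen u) (gen v) :> palg by rewrite pmul_gen e.
by move=> [] [h h0]; [apply: JRRJ_r|apply: JRRJ_l] => //; apply: Rideal_long.
Qed.

(** The nontrivial factor among u and v is pulled out; the rest stays in R. *)
Lemma JRRJ_subst s t u v r r' : parallel s t -> plen s = plen t ->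
    pcat3 u s v = Some r -> pcat3 u t v = Some r' -> (0 < plen u + plen v)%N ->
  gen r - gen r' \in JRRJ G K.
Proof.
move=> [e1 e2] est /pcat3E [us [sv [h1 h2 h3 h4]]].
move=> /pcat3E [ut [tv [k1 k2 k3 k4]]].
case: (posnP (plen u)) => [->|u0 _].
  rewrite add0n => v0.
  have -> : gen r - gen r' = pmul (gen us - gen ut) (gen v) :> palg.
    by rewrite pmulBl; congr (_ - _); apply/esym/pmul_Some.
  apply: JRRJ_r => //; apply: Rideal_parallel.
    by split; [rewrite (pcat_src h1) (pcat_src k1)
             |rewrite (pcat_tgt h1) (pcat_tgt k1)].
  by rewrite (pcat_plen h1) (pcat_plen k1) est.
have -> : gen r - gen r' = pmul (gen u) (gen sv - gen tv) :> palg.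
  by rewrite linearB /=; congr (_ - _); apply/esym/pmul_Some.
apply: JRRJ_l => //; apply: Rideal_parallel.
  by split; [rewrite (pcat_src h2) (pcat_src k2)
             |rewrite (pcat_tgt h2) (pcat_tgt k2)].
by rewrite (pcat_plen h2) (pcat_plen k2) est.
Qed.


End Algebra.

(** * Paths in the ideal J *)

Section PositivePaths.
Variables (G : digraph) (K : comPzRingType).
Local Notation palg := (palg G K).
Implicit Types (p q r s t u v : gpath G) (a b c : palg).

Lemma pmul_mem (S : submodClosed palg) a b :
  (forall p q, p \in msupp a -> q \in msupp b -> ogen (pcat p q) \in S) ->
  pmul a b \in S.
Proof.
move=> h; pose f : {linear palg -> palg} :=
  lext (fun p => lext (fun q => ogen (pcat p q) : palg) b).
apply: (freemod_sub (f := f)) => p pa; rewrite /f /= lext_gen.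
pose g : {linear palg -> palg} := lext (fun q => ogen (pcat p q) : palg).
apply: (freemod_sub (f := g)) => q qb; rewrite /g /= lext_gen.
exact: h.
Qed.

Definition posS : {pred palg} :=
  fun a => all (fun p => (0 < plen p)%N) (msupp a).

Lemma posP a : reflect (forall p, plen p = 0%N -> a@_p = 0) (a \in posS).
Proof.
apply: (iffP allP) => [h p p0|h p].
  by apply: mcoeff_outdom; apply/negP => /h; rewrite p0.
by rewrite -mcoeff_neq0 lt0n; apply: contra_neq => /h.
Qed.

Lemma posS_closed : subsemimod_closed posS.
Proof.
split; first split.
- by apply/posP => p _; rewrite mcoeff0.
- move=> a b /posP ha /posP hb; apply/posP => p pl.
  by rewrite mcoeffD ha // hb // addr0.
- move=> c a /posP ha; apply/posP => p pl.
  by rewrite [LHS]fm_scaleE ha // mulr0.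
Qed.
HB.instance Definition _ := GRing.isSubmodClosed.Build K palg posS posS_closed.

Lemma posS_gen p : (0 < plen p)%N -> gen p \in posS.
Proof.
move=> p0; apply/posP => q q0; rewrite mcoeffU.
by case: eqP p0 => // ->; rewrite q0.
Qed.

Lemma posS_ideal : is_ideal posS.
Proof.
move=> a b /allP hb; split; apply: pmul_mem => p q hp hq.
  case E : (pcat p q) => [r|] /=; last exact: rpred0.
  by apply: posS_gen; rewrite (pcat_plen E) addn_gt0 (hb _ hq) orbT.
case E : (pcat p q) => [r|] /=; last exact: rpred0.
by apply: posS_gen; rewrite (pcat_plen E) addn_gt0 (hb _ hp).
Qed.

Lemma Jideal_msupp a p : a \in Jideal G K -> p \in msupp a -> (0 < plen p)%N.
Proof.
move=> /asboolP aJ; move: p; apply/allP.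
apply: (aJ posS); first exact: posS_ideal.
by move=> _ [p p0 ->]; apply: posS_gen.
Qed.

End PositivePaths.

(** * The quotient of the path algebra by JR + RJ *)

Section PathAlgebraQuotient.
Variables (G : digraph) (K : comPzRingType) (l : nat).
Local Notation palg := (palg G K).
Local Notation F := (freemod K (PNbar G l)).
Implicit Types (p q r s t u v : gpath G) (a b c : palg).

Lemma cgen_Nbar (c : Pbar G l) : c \in @Nbar G l -> cgen K c = 0.
Proof. by move=> cN; rewrite /cgen insubF ?cN. Qed.

Lemma cgen_val (c : PNbar G l) : cgen K (val c) = gen c.
Proof. by rewrite /cgen valK. Qed.

Lemma lext_cgen (V : lmodType K) (f : PNbar G l -> V) (c : Pbar G l) :
  lext f (cgen K c) = oapp f 0 (insub c).
Proof. exact: lext_ogen. Qed.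

(** Extended by zero to paths of other lengths, which makes [classmap] defined
    on the whole path algebra. *)
Definition lclass p : F :=
  oapp (fun p' : lpath G l => cgen K (pclass p')) 0 (insub p).
Definition classmap : palg -> F := lext lclass.
HB.instance Definition _ := GRing.Linear.on classmap.

Lemma lclass_val (p : lpath G l) : lclass (val p) = cgen K (pclass p).
Proof. by rewrite /lclass valK. Qed.

Lemma lclass_out p : plen p != l -> lclass p = 0.
Proof. by move=> pl; rewrite /lclass insubF //; apply/negbTE. Qed.

Lemma lpathP p : plen p = l -> exists p' : lpath G l, val p' = p.
Proof. by move=> /eqP pl; exists (Sub p pl). Qed.

Lemma classmap_gen p : classmap (gen p) = lclass p.
Proof. exact: lext_gen. Qed.

(** A context of positive length forces s and t to be shorter than l. *)
Lemma lclass_subst s t u v r r' : (1 <= plen u + plen v)%N ->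
  shortest s -> shortest t -> parallel s t -> plen s = plen t ->
  pcat3 u s v = Some r -> pcat3 u t v = Some r' -> lclass r = lclass r'.
Proof.
move=> uv ss st pst est hr hr'.
have lr := pcat3_plen hr; have lr' := pcat3_plen hr'.
have err' : plen r = plen r' by rewrite lr lr' est.
case: (eqVneq (plen r) l) => [rl|rl]; last by rewrite !lclass_out -?err'.
have [p ep] := lpathP rl; have [q eq] := lpathP (etrans (esym err') rl).
rewrite -ep -eq !lclass_val; congr cgen.
apply: (pclass_subst ss st pst _ (u := u) (v := v)); rewrite ?ep ?eq //.
by rewrite -rl lr; lia.
Qed.

Lemma lclass_nonminimal p : nonminimal p -> lclass p = 0.
Proof.
move=> np; case: (eqVneq (plen p) l) => [/lpathP [q eq]|]; last exact: lclass_out.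
rewrite -eq lclass_val cgen_Nbar //; apply/NbarP; exists q => //.
by rewrite eq.
Qed.

Lemma lclass_pcat3_long u p v r : (1 <= plen u + plen v)%N -> long p ->
  pcat3 u p v = Some r -> lclass r = 0.
Proof.
move=> uv lp hr; apply: lclass_nonminimal.
apply: (@nonminimal_subpath _ p) => //.
  by apply/subpath_pcat3; exists u, v.
by rewrite (pcat3_plen hr); lia.
Qed.

Lemma classmap_pmull p b :
  classmap (pmul (gen p) b) = sandwich lclass (Some p) None b.
Proof.
rewrite pmul_genl.
pose f : {linear palg -> palg} := lext (fun q => ogen (pcat p q) : palg).
apply: (freemod_ext (f := classmap \o f)) => q /=.
rewrite /f /= lext_gen sandwich_gen /act /=.
by case: (pcat p q) => [r|] /=; rewrite ?classmap_gen ?raddf0.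
Qed.

Lemma classmap_pmulr p b :
  classmap (pmul b (gen p)) = sandwich lclass None (Some p) b.
Proof.
rewrite pmul_genr.
pose f : {linear palg -> palg} := lext (fun q => ogen (pcat q p) : palg).
apply: (freemod_ext (f := classmap \o f)) => q /=.
rewrite /f /= lext_gen sandwich_gen /act /=.
by case: (pcat q p) => [r|] /=; rewrite ?classmap_gen ?raddf0.
Qed.

Lemma classmap_JRRJ a : a \in JRRJ G K -> classmap a = 0.
Proof.
have key o o' b : b \in Rideal G K -> (1 <= olen o + olen o')%N ->
    sandwich lclass o o' b = 0.
  move=> bR h; apply: (Rideal_ann _ _ bR h).
    by move=> u s t v r r'; apply: lclass_subst.
  by move=> u p v r; apply: lclass_pcat3_long.
move=> /asboolP [u [w [/asboolP hu /asboolP hw ->]]].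
have /eqP hu0 : classmap u == 0.
  apply: (hu (kerS classmap)) => _ [x [y [xJ yR ->]]].
  apply/eqP/pmul_subl => p px.
  by rewrite /= classmap_pmull key //= addn0; apply: Jideal_msupp xJ px.
have /eqP hw0 : classmap w == 0.
  apply: (hw (kerS classmap)) => _ [x [y [xR yJ ->]]].
  apply/eqP/pmul_subr => p py.
  by rewrite /= classmap_pmulr key //= add0n; apply: Jideal_msupp yJ py.
by rewrite raddfD /= hu0 hw0 addr0.
Qed.

(** A section of [classmap], obtained by choosing a path in each class. *)
Definition classlift : F -> palg :=
  lext (fun c : PNbar G l => gen (val (repr (val c)))).
HB.instance Definition _ := GRing.Linear.on classlift.

Lemma classlift_gen (c : PNbar G l) :
  classlift (gen c) = gen (val (repr (val c))).
Proof. exact: lext_gen. Qed.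

Lemma JRRJ_pclass (p q : lpath G l) : pclass p = pclass q ->
  gen (val p) - gen (val q) \in JRRJ G K.
Proof.
move=> epq; apply/quot_eq.
apply: (pclass_ind (h := fun r => \pi_(quotmod (JRRJ G K)) (gen r))) epq.
move=> s t u v r r' ss st pst est sl rl _ hr hr'; apply/quot_eq.
apply: (JRRJ_subst _ pst est hr hr').
by have := pcat3_plen hr; lia.
Qed.

Lemma JRRJ_Nbar (p : lpath G l) : pclass p \in @Nbar G l ->
  gen (val p) \in JRRJ G K.
Proof.
move=> /NbarP [q nq epq]; rewrite -[gen _](subrK (gen (val q))).
by apply: rpredD; [apply: JRRJ_pclass|apply: JRRJ_nonminimal].
Qed.

(** Modulo JR + RJ, a path is determined by its class and vanishes when the
    class is in Nbar. *)
Lemma classlift_classmap (p : lpath G l) :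
  gen (val p) - classlift (classmap (gen (val p))) \in JRRJ G K.
Proof.
rewrite classmap_gen lclass_val.
have [pN|pN] := boolP (pclass p \in @Nbar G l).
  by rewrite cgen_Nbar // raddf0 subr0; apply: JRRJ_Nbar.
rewrite -[pclass p]/(val (Sub (pclass p) pN : PNbar G l)) cgen_val
   classlift_gen.
by apply: JRRJ_pclass; rewrite pclass_repr_val.
Qed.

Lemma classmap_ker a : a \in homog l -> classmap a = 0 -> a \in JRRJ G K.
Proof.
move=> ha pa; rewrite -[a]subr0 -(raddf0 classlift) -pa.
pose f : {linear palg -> palg} := idfun \- (classlift \o classmap).
apply: (freemod_sub (f := f)) => p ps.
have [q <-] := lpathP (eqP (allP ha p ps)).
exact: classlift_classmap.
Qed.

Lemma classmap_classlift (u : F) : classmap (classlift u) = u.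
Proof.
apply: (freemod_ext (f := classmap \o classlift) (g := idfun)) => c /=.
by rewrite classlift_gen classmap_gen lclass_val pclass_repr cgen_val.
Qed.

Lemma classlift_homog (u : F) : classlift u \in homog l.
Proof.
apply: (freemod_sub (f := classlift)) => c _ /=; rewrite classlift_gen.
by have /andP [] := lpath_homog K (repr (val c)).
Qed.

(** [classmap] and [classlift] are inverse to each other modulo JR + RJ. *)
Lemma palg_mod_to_classes : exists Phi : {linear palg_mod G K l -> F},
  bijective Phi /\ forall a (aG : a \in capS (fullS palg) (homog l)),
    Phi (sqclass (JRRJ G K) aG) = classmap a.
Proof.
have [a _|Phi [PhiE Phir Phii]] :=
    @subquot_lift _ _ _ (capS (fullS palg) (homog l)) (JRRJ G K) classmap.
  exact: classmap_JRRJ.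
exists Phi; split=> //.
have chiZ (u : F) : classlift u \in capS (fullS palg) (homog l).
  by apply/andP; split; last exact: classlift_homog.
have PhiK (u : F) : Phi (sqclass (JRRJ G K) (chiZ u)) = u.
  exact: etrans (PhiE _ _) (classmap_classlift u).
exists (fun u : F => sqclass (JRRJ G K) (chiZ u)) => // x.
apply: Phii => // v /andP [_ vh]; exact: classmap_ker.
Qed.

End PathAlgebraQuotient.

(** * The image of R and its basis *)

Section Generators.
Variables (G : digraph) (K : comPzRingType) (l : nat).
Local Notation palg := (palg G K).
Local Notation F := (freemod K (PNbar G l)).
Local Notation Ends := (freemod K (G * G)%type).
Implicit Types (p q r : gpath G) (c : Pbar G l).

Lemma shortest_class (p : lpath G l) :
  (dist (csrc (pclass p)) (ctgt (pclass p)) == enat l) = shortest (val p).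
Proof. by have [-> ->] := pclass_parallel p; rewrite /shortest lpath_len. Qed.

Lemma short_notin_Nbar c :
  dist (csrc c) (ctgt c) == enat l -> c \notin @Nbar G l.
Proof.
rewrite -[c]pclass_repr shortest_class; apply: contraL => /Nbar_long.
by rewrite /long.
Qed.

Definition ends c : Ends :=
  if dist (csrc c) (ctgt c) == enat l then gen (csrc c, ctgt c) else 0.
(** Its kernel is the common description of R_l modulo JR + RJ and of MH_2. *)
Definition endmap : F -> Ends := lext (fun c : PNbar G l => ends (val c)).
HB.instance Definition _ := GRing.Linear.on endmap.

Lemma endmap_cgen c : endmap (cgen K c) = ends c.
Proof.
rewrite /endmap lext_cgen; case: insubP => [c' _ /= -> //|].
rewrite negbK => cN /=; rewrite /ends ifN //.
by apply: contraL cN => /short_notin_Nbar.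
Qed.

Lemma endmap_pclass (p : lpath G l) : endmap (cgen K (pclass p)) =
  if shortest (val p) then gen (src (val p), tgt (val p)) else 0.
Proof.
rewrite endmap_cgen /ends shortest_class.
by have [-> ->] := pclass_parallel p.
Qed.

Lemma endmap_lclass p q : parallel p q -> plen p = plen q ->
  endmap (lclass K l p) = endmap (lclass K l q).
Proof.
move=> pq epq; case: (eqVneq (plen p) l) => [pl|pl]; last first.
  by rewrite !lclass_out -?epq.
have ql : plen q = l by rewrite -epq.
have [p' ep] := lpathP pl; have [q' eq] := lpathP ql.
rewrite -ep -eq !lclass_val !endmap_pclass ep eq /shortest.
by case: pq => -> ->; rewrite epq.
Qed.

Lemma endmap_lclass_long p : long p -> endmap (lclass K l p) = 0.
Proof.
move=> lp; case: (eqVneq (plen p) l) => [/lpathP [q eq]|pl].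
  by rewrite -eq lclass_val endmap_pclass eq (negbTE lp).
by rewrite lclass_out // raddf0.
Qed.

(** On generators of R this is the equality of endpoints of s and t in s - t,
    respectively the fact that a path containing a long one is long. *)
Lemma endmap_classmap_R b : b \in Rideal G K -> endmap (classmap l b) = 0.
Proof.
move=> bR; pose psi p := endmap (lclass K l p).
have -> : endmap (classmap l b) = sandwich psi None None b.
  apply: (freemod_ext (f := endmap \o classmap l)) => p /=.
  by rewrite classmap_gen sandwich_gen.
apply: (@Rideal_ann _ _ _ 0 psi _ _ _ bR) => //.
  move=> u s t v r r' _ _ _ pst est hr hr'; apply: endmap_lclass.
    exact: (cong_cat (parallel_congruence G) pst hr hr').
  by rewrite (pcat3_plen hr) (pcat3_plen hr') est.
move=> u p v r _ lp hr; apply: endmap_lclass_long.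
by apply: contra lp; apply: shortest_subpath; apply/subpath_pcat3; exists u, v.
Qed.

Variable s : forall x y : G, dist x y == enat l -> lpath G l.
Hypothesis hs : forall (x y : G) (h : dist x y == enat l),
  src (val (s h)) = x /\ tgt (val (s h)) = y.

Local Notation I := (index1 s + @index2 G l)%type.

Lemma chosen_ends (c : shclass G l) :
  csrc (chosen s c) = csrc (val c) /\ ctgt (chosen s c) = ctgt (val c).
Proof.
have [-> ->] := pclass_parallel (s (valP c)).
exact: hs.
Qed.

Lemma chosen_shortest (c : shclass G l) :
  dist (csrc (chosen s c)) (ctgt (chosen s c)) == enat l.
Proof. by have [-> ->] := chosen_ends c; exact: valP c. Qed.

Lemma chosen_eq (c c' : shclass G l) : csrc (val c) = csrc (val c') ->
  ctgt (val c) = ctgt (val c') -> chosen s c = chosen s c'.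
Proof.
case: c c' => [c hc] [c' hc'] /= e1 e2; rewrite /chosen /=.
move: (valP (exist _ c hc : shclass G l)) (valP (exist _ c' hc' : shclass G l)).
by rewrite /= e1 e2 => h h'; rewrite (bool_irrelevance h h').
Qed.

(** The generator in which a class occurs with coefficient 1; the chosen classes
    have none. *)
Definition generator_index c : option I :=
  if (insub c : option (shclass G l)) is Some c'
  then omap inl (insub c' : option (index1 s))
  else omap inr (insub c : option (index2 G l)).

Definition generator_coord : F -> freemod K I :=
  lext (fun c : PNbar G l => ogen (generator_index (val c))).
HB.instance Definition _ := GRing.Linear.on generator_coord.

Definition chosen_gen (xy : G * G) : F :=
  oapp (fun z : {xy : G * G | dist xy.1 xy.2 == enat l} =>
          cgen K (pclass (s (valP z)))) 0 (insub xy).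
Definition chosen_lift : Ends -> F := lext chosen_gen.
HB.instance Definition _ := GRing.Linear.on chosen_lift.

Lemma chosen_gen_chosen (c : shclass G l) :
  chosen_gen (csrc (val c), ctgt (val c)) = cgen K (chosen s c).
Proof.
rewrite /chosen_gen insubT /=; first exact: valP c.
move=> h; rewrite /chosen.
by congr (cgen K (pclass (s _))); apply: bool_irrelevance.
Qed.

Lemma lext_generator_ogen (o : option I) :
  lext (generator K s) (ogen o) = oapp (generator K s) 0 o.
Proof. exact: lext_ogen. Qed.

Lemma generator_coord_gen (c : PNbar G l) :
  lext (generator K s) (generator_coord (gen c)) =
    gen c - chosen_lift (endmap (gen c)).
Proof.
rewrite /generator_coord lext_gen lext_generator_ogen -[in RHS](cgen_val K c).
rewrite endmap_cgen /ends /generator_index.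
case: insubP => [c' -> e|nc] /=; last first.
  rewrite ifN // raddf0 subr0; case: insubP => [c' _ /= -> //|] /=.
  rewrite (valP c) andbT => /negP []; apply/asboolP.
  exists (repr (val c)); last exact: pclass_repr.
  by rewrite /long -shortest_class pclass_repr.
rewrite -e [chosen_lift _]lext_gen chosen_gen_chosen.
case: insubP => [c'' _ /= -> //|] /=.
by rewrite negbK => /eqP <-; rewrite subrr.
Qed.

(** Replacing each non-chosen class by its generator changes u by a combination of
    chosen classes, whose coefficients are read off from [endmap]. *)
Lemma generator_coordK (u : F) :
  lext (generator K s) (generator_coord u) = u - chosen_lift (endmap u).
Proof.
apply: (freemod_ext (f := lext (generator K s) \o generator_coord)
                    (g := idfun \- (chosen_lift \o endmap))) => c.
exact: generator_coord_gen.
Qed.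

Lemma generator_coord_cgen c : c \notin @Nbar G l ->
  generator_coord (cgen K c) = ogen (generator_index c).
Proof. by move=> cN; rewrite /generator_coord lext_cgen insubT. Qed.

(** The subtracted chosen class has no coordinate, so [generator_coord] is a left
    inverse of the linear extension of [generator]. *)
Lemma generator_coord_generator (i : I) :
  generator_coord (generator K s i) = gen i.
Proof.
case: i => [c|c] /=; last first.
  have /andP [/asboolP [p lp ep] cN] := valP c.
  rewrite generator_coord_cgen // /generator_index insubF; last first.
    by rewrite -ep shortest_class; apply/negbTE.
  by rewrite valK.
have cs := valP (val c); have chs := chosen_shortest (val c).
rewrite raddfB /= !generator_coord_cgen ?short_notin_Nbar // /generator_index.
rewrite valK /= valK /=
  (insubT (fun c => dist (csrc c) (ctgt c) == enat l) chs) /=.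
rewrite insubF /= ?subr0 //; apply/negbTE; rewrite negbK /=.
by have [e1 e2] := chosen_ends (val c); apply/eqP/esym/chosen_eq.
Qed.

Lemma generator_injective : injective (lext (generator K s)).
Proof.
apply: (can_inj (g := generator_coord)) => u.
apply: (freemod_ext (f := generator_coord \o lext (generator K s))
                    (g := idfun)) => i /=.
by rewrite lext_gen generator_coord_generator.
Qed.

(** Preimages of the generators in the degree l part of R. *)
Definition generator_lift (i : I) : palg :=
  match i with
  | inl c => gen (val (repr (val (val c)))) - gen (val (s (valP (val c))))
  | inr c => gen (val (repr (val c)))
  end.

Lemma generator_lift_mem i : generator_lift i \in capS (Rideal G K) (homog l).
Proof.
have hom (p : lpath G l) : (gen (val p) : palg) \in homog l.
  by have /andP [] := lpath_homog K p.
case: i => [c|c] /=; apply/andP; split=> //.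
- apply: Rideal_parallel; last by rewrite !lpath_len.
  have [e1 e2] := hs (valP (val c)).
  by split; rewrite ?e1 ?e2.
- apply: (submodB (S := homog l)); exact: hom.
- apply: Rideal_long; have /andP [/asboolP [p lp ep] _] := valP c.
  by rewrite (@pclass_long _ _ _ p) // pclass_repr.
- exact: hom.
Qed.

Lemma classmap_generator_lift i :
  classmap l (generator_lift i) = generator K s i.
Proof.
case: i => [c|c] /=; last by rewrite classmap_gen lclass_val pclass_repr.
rewrite raddfB /=; congr (_ - _).
  by rewrite classmap_gen lclass_val pclass_repr.
by rewrite classmap_gen lclass_val.
Qed.

Lemma classmap_R_range :
  (classmap l @` [set` capS (Rideal G K) (homog l)])%classic =
  range (lext (generator K s)).
Proof.
apply/seteqP; split=> [_ [v /andP [vR _] <-]|_ [u _ <-]].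
  exists (generator_coord (classmap l v)) => //.
  by rewrite generator_coordK endmap_classmap_R // raddf0 subr0.
pose gamma : {linear freemod K I -> palg} := lext generator_lift.
exists (gamma u).
  by apply: (freemod_sub (f := gamma)) => i _;
    rewrite /gamma /= lext_gen generator_lift_mem.
apply: (freemod_ext (f := classmap l \o gamma)) => i.
by rewrite /gamma /= !lext_gen classmap_generator_lift.
Qed.

Lemma endmap_ker (u : F) : endmap u = 0 <-> range (lext (generator K s)) u.
Proof.
split=> [du|].
  by exists (generator_coord u) => //; rewrite generator_coordK du raddf0 subr0.
by rewrite -classmap_R_range => -[v /andP [vR _] <-]; apply: endmap_classmap_R.
Qed.

End Generators.

(** * Magnitude chains as cut paths *)

Local Notation nondegenerate := Defs.nondegenerate.

Section Magnitude.
Variables (G : digraph) (K : comPzRingType) (l : nat).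
Local Notation F := (freemod K (PNbar G l)).
Local Notation Ends := (freemod K (G * G)%type).
Implicit Types (p q r t : gpath G) (x y z w : G).

Lemma tuple2P (X : 2.-tuple G) : exists x y, X = [tuple x; y].
Proof. by case: X => -[|x [|y [|]]] // h; exists x, y; apply: val_inj. Qed.

Lemma tuple2_eta (X : 2.-tuple G) : [tuple tnth X ord0; tnth X ord_max] = X.
Proof. by have [x [y ->]] := tuple2P X; apply: val_inj. Qed.

Lemma tuple3P (X : 3.-tuple G) : exists x y z, X = [tuple x; y; z].
Proof. by case: X => -[|x [|y [|z [|]]]] // h; exists x, y, z; apply: val_inj. Qed.

Lemma tuple4P (X : 4.-tuple G) : exists x y z w, X = [tuple x; y; z; w].
Proof.
by case: X => -[|x [|y [|z [|w [|]]]]] // h; exists x, y, z, w; apply: val_inj.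
Qed.

Lemma norm2 x y : norm [tuple x; y] = dist x y.
Proof. by rewrite /norm !big_ord_recl big_ord0 adde0. Qed.

Lemma norm3 x y z : norm [tuple x; y; z] = (dist x y + dist y z)%E.
Proof. by rewrite /norm !big_ord_recl big_ord0 adde0. Qed.

Lemma norm4 x y z w :
  norm [tuple x; y; z; w] = (dist x y + (dist y z + dist z w))%E.
Proof. by rewrite /norm !big_ord_recl big_ord0 adde0. Qed.

Lemma nondeg2 x y : nondegenerate [tuple x; y] = (x != y).
Proof. by apply/forallP/idP => [/(_ ord0) //|xy [[|]]]. Qed.

Lemma nondeg3 x y z : nondegenerate [tuple x; y; z] = (x != y) && (y != z).
Proof.
apply/forallP/andP => [h|[xy yz] [[|[|]]]] //.
by split; [apply: (h ord0)|apply: (h ord_max)].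
Qed.

Lemma nondeg4 x y z w :
  nondegenerate [tuple x; y; z; w] = [&& x != y, y != z & z != w].
Proof.
apply/forallP/and3P => [h|[xy yz zw] [[|[|[|]]]]] //.
by split; [apply: (h ord0)|apply: (h (lift ord0 ord0))|apply: (h ord_max)].
Qed.

Lemma enatD m n : (enat m + enat n)%E = enat (m + n).
Proof. by []. Qed.

Definition pair x y : MC G K 1 l :=
  ogen (insub [tuple x; y] : option (chain G 1 l)).

(** Zero when the triple is not a chain of norm l, so that terms of a boundary can
    be written without case distinction. *)
Definition tri x y z : MC G K 2 l :=
  ogen (insub [tuple x; y; z] : option (chain G 2 l)).

(** Puts faces in a form that computes on explicit tuples. *)
Lemma del_tuple n (i : 'I_n.+2) (X : n.+2.-tuple G) x0 :
  del i X = [seq nth x0 X (bump i j) | j <- iota 0 n.+1] :> seq G.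
Proof.
rewrite -val_enum_ord -map_comp; apply: eq_map => j /=.
by rewrite (tnth_nth x0).
Qed.

Lemma alternating_sum4 (V : lmodType K) (f : 'I_4 -> V) a b c d :
    f (inord 0) = a -> f (inord 1) = b -> f (inord 2) = c -> f (inord 3) = d ->
  \sum_(i < 4) (-1) ^+ i *: f i = a - b + c - d.
Proof.
move=> <- <- <- <-.
have e k (h : (k < 4)%N) : inord k = Ordinal h :> 'I_4.
  by apply: val_inj; rewrite /= inordK.
rewrite !big_ord_recl big_ord0 addr0 /= !e !addrA.
rewrite expr0 expr1 -signr_odd expr0 -[_ ^+ 3]signr_odd expr1
  !scale1r !scaleN1r.
by congr (f _ - f _ + f _ - f _); apply: val_inj.
Qed.

Lemma alternating_sum3 (V : lmodType K) (f : 'I_3 -> V) a b c :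
    f (inord 0) = a -> f (inord 1) = b -> f (inord 2) = c ->
  \sum_(i < 3) (-1) ^+ i *: f i = a - b + c.
Proof.
move=> <- <- <-.
have e k (h : (k < 3)%N) : inord k = Ordinal h :> 'I_3.
  by apply: val_inj; rewrite /= inordK.
rewrite !big_ord_recl big_ord0 addr0 /= !e !addrA.
rewrite expr0 expr1 -signr_odd expr0 !scale1r !scaleN1r.
by congr (f _ - f _ + f _); apply: val_inj.
Qed.

Lemma faceE n (X : chain G n.+1 l) (i : 'I_n.+2) (Y : n.+1.-tuple G) x0 :
    [seq nth x0 (val X) (bump i j) | j <- iota 0 n.+1] = Y ->
  face K i X = ogen (insub Y : option (chain G n l)).
Proof.
move=> e; congr (ogen (insub _)); apply: val_inj.
exact: etrans (del_tuple _ _ x0) e.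
Qed.

Lemma boundary3 (X : chain G 3 l) x y z w : val X = [tuple x; y; z; w] ->
  boundary (gen X : MC G K 3 l) = tri y z w - tri x z w + tri x y w - tri x y z.
Proof.
move=> eX; apply: etrans (lext_gen _ _) _.
by apply: alternating_sum4; apply: (faceE (x0 := x)); rewrite eX /= inordK.
Qed.

Lemma boundary2 (X : chain G 2 l) x y z : val X = [tuple x; y; z] ->
  boundary (gen X : MC G K 2 l) = pair y z - pair x z + pair x y.
Proof.
move=> eX; apply: etrans (lext_gen _ _) _.
by apply: alternating_sum3; apply: (faceE (x0 := x)); rewrite eX /= inordK.
Qed.

Lemma dist_long p : long p ->
  exists2 n, (n < plen p)%N & dist (src p) (tgt p) = enat n.
Proof.
move=> lp; have [n np d] := dist_path_ex p; exists n => //.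
rewrite ltn_neqAle np andbT; apply: contra lp => /eqP e.
by rewrite /shortest d e.
Qed.

(** The norm of the cut is at most l, with equality exactly when neither piece
    has a shortcut. *)
Lemma chain2_cut q r : tgt q = src r -> (0 < plen q)%N -> (0 < plen r)%N ->
    (plen q + plen r)%N = l ->
  (nondegenerate [tuple src q; tgt q; tgt r] &&
     (norm [tuple src q; tgt q; tgt r] == enat l)) = shortest q && shortest r.
Proof.
move=> e q0 r0 el; rewrite nondeg3 norm3.
have [sq|lq] := boolP (shortest q); have [sr|lr] := boolP (shortest r) => /=.
- rewrite (shortest_vertices sq) e (shortest_vertices sr) -!lt0n q0 r0 /=.
  by rewrite -e (shortest_dist sq) e (shortest_dist sr) enatD el eqxx.
- have [n nr d] := dist_long lr.
  rewrite (shortest_dist sq) e d enatD; apply/negbTE/nandP; right.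
  by apply/eqP => /enat_inj; lia.
- have [n nr d] := dist_long lq.
  rewrite d e (shortest_dist sr) enatD; apply/negbTE/nandP; right.
  by apply/eqP => /enat_inj; lia.
- have [n nr d] := dist_long lq; have [n' nr' d'] := dist_long lr.
  rewrite d e d' enatD; apply/negbTE/nandP; right.
  by apply/eqP => /enat_inj; lia.
Qed.

Lemma tri_long q r : tgt q = src r -> (0 < plen q)%N -> (0 < plen r)%N ->
    (plen q + plen r)%N = l -> ~~ (shortest q && shortest r) ->
  tri (src q) (tgt q) (tgt r) = 0.
Proof.
move=> e q0 r0 el lqr; rewrite /tri insubF //.
by rewrite chain2_cut //; apply/negbTE.
Qed.

Lemma shortest_pos q : shortest q -> src q != tgt q -> (0 < plen q)%N.
Proof. by move=> /shortest_vertices ->; rewrite lt0n. Qed.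

Lemma dist_fin x y (k : int) : dist x y = k%:E ->
  exists q, [/\ src q = x, tgt q = y, shortest q & k = plen q].
Proof.
case: (dist_cases x y) => [-> //|[q [<- <- sq]]].
by rewrite (shortest_dist sq) => -[<-]; exists q.
Qed.

Lemma dist_add_fin x y (k : int) (e : \bar int) : (dist x y + e)%E = k%:E ->
  exists q, [/\ src q = x, tgt q = y, shortest q & e = (k - (plen q)%:Z)%:E].
Proof.
case: (dist_cases x y) => [->|[q [<- <- sq]]]; first by case: e.
rewrite (shortest_dist sq); case: e => [m| |] //= [<-]; exists q; split=> //.
by congr (_%:E); lia.
Qed.

Lemma chain2_paths (X : chain G 2 l) : exists q r,
  [/\ tgt q = src r, (0 < plen q)%N /\ (0 < plen r)%N, (plen q + plen r)%N = l,
      shortest q && shortest r & val X = [tuple src q; tgt q; tgt r]].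
Proof.
case: X => X /= /[dup] h; have [x [y [z ->]]] := tuple3P X.
rewrite nondeg3 norm3 => /andP [/andP [xy yz] /eqP d].
have [q [q1 q2 sq /dist_fin [r [r1 r2 sr el]]]] := dist_add_fin d.
exists q, r; rewrite q1 q2 r2 r1 sq sr; split=> //; last by lia.
by split; apply: shortest_pos; rewrite // ?q1 ?q2 ?r1 ?r2.
Qed.

Lemma chain3_paths (X : chain G 3 l) : exists q r t,
  [/\ tgt q = src r, tgt r = src t,
      [/\ (0 < plen q)%N, (0 < plen r)%N & (0 < plen t)%N],
      (plen q + (plen r + plen t))%N = l /\
      [/\ shortest q, shortest r & shortest t] &
      val X = [tuple src q; tgt q; tgt r; tgt t]].
Proof.
case: X => X /= /[dup] h; have [x [y [z [w ->]]]] := tuple4P X.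
rewrite nondeg4 norm4 => /andP [/and3P [xy yz zw] /eqP d].
have [q [q1 q2 sq d']] := dist_add_fin d.
have [r [r1 r2 sr /dist_fin [t [t1 t2 st el]]]] := dist_add_fin d'.
exists q, r, t; rewrite q1 q2 r2 r1 t1 t2; split=> //; last by split=> //; lia.
by split; apply: shortest_pos; rewrite // ?q1 ?q2 ?r1 ?r2 ?t1 ?t2.
Qed.

Definition cut_of (P : lpath G l) (X : chain G 2 l) := exists q r,
  [/\ pcat q r = Some (val P), (0 < plen q)%N /\ (0 < plen r)%N,
      shortest q && shortest r & val X = [tuple src q; tgt q; tgt r]].

Lemma cut_of_ex X : exists P, cut_of P X.
Proof.
have [q [r [e [q0 r0] el sqr eX]]] := chain2_paths X.
have [p hp] := pcat_ex e.
have [P hP] : exists P : lpath G l, val P = p.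
  by apply: lpathP; rewrite (pcat_plen hp).
by exists P, q, r; rewrite hP.
Qed.

(** Two paths cut as the same triple differ by replacing shortest pieces, both
    shorter than l because the other piece is nonempty. *)
Lemma cut_of_eq P P' X : cut_of P X -> cut_of P' X -> pclass P = pclass P'.
Proof.
move=> [q [r [h [q0 r0] /andP [sq sr] eX]]].
move=> [q' [r' [h' [q0' r0'] /andP [sq' sr'] eX']]].
have [e1 e2 e3] : [/\ src q = src q', tgt q = tgt q' & tgt r = tgt r'].
  by move: eX'; rewrite eX => -[].
have qq' : parallel q q' by [].
have rr' : parallel r r'.
  by split=> //; rewrite -(pcat_tgt_src h) e2 (pcat_tgt_src h').
have lq := shortest_plen sq sq' qq'; have lr := shortest_plen sr sr' rr'.
have lP := pcat_plen h; rewrite lpath_len in lP.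
have lP' := pcat_plen h'; rewrite lpath_len in lP'.
have [m hm] : exists m, pcat q' r = Some m.
  by apply: pcat_ex; rewrite -e2 (pcat_tgt_src h).
have [M hM] : exists M : lpath G l, val M = m.
  by apply: lpathP; rewrite (pcat_plen hm) -lq -lP.
(* M combines the new first piece with the old second one *)
transitivity (pclass M).
  apply: (pclass_subst sq sq' qq' _ (u := trivial_path (src q)) (v := r)).
    by lia.
    by rewrite /pcat3 pcat_vsrc.
  by rewrite /pcat3 e1 pcat_vsrc /= hm hM.
apply: (pclass_subst sr sr' rr' _ (u := q') (v := trivial_path (tgt r))).
  by lia.
  by rewrite /pcat3 hm hM /= -hM -(pcat_tgt hm) -hM pcat_vtgt.
by rewrite /pcat3 h' /= e3 -(pcat_tgt h') pcat_vtgt.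
Qed.

Definition cut_class (X : chain G 2 l) : F :=
  cgen K (pclass (sval (cid (cut_of_ex X)))).
Definition cutmap : MC G K 2 l -> F := lext cut_class.
HB.instance Definition _ := GRing.Linear.on cutmap.

Lemma cutmap_gen X P : cut_of P X -> cutmap (gen X) = cgen K (pclass P).
Proof.
move=> cP; rewrite /cutmap lext_gen /cut_class; congr cgen.
exact: cut_of_eq (svalP (cid (cut_of_ex X))) cP.
Qed.

(** A long piece makes the triple zero and puts the class of P in Nbar;
    otherwise the triple is a basis element cut from P. *)
Lemma cutmap_tri q r (P : lpath G l) : pcat q r = Some (val P) ->
    (0 < plen q)%N -> (0 < plen r)%N ->
  cutmap (tri (src q) (tgt q) (tgt r)) = cgen K (pclass P).
Proof.
move=> h q0 r0; have e := pcat_tgt_src h.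
have lP := pcat_plen h; rewrite lpath_len in lP.
have [sqr|lqr] := boolP (shortest q && shortest r).
  have cX := chain2_cut e q0 r0 (esym lP); rewrite sqr in cX.
  pose X : chain G 2 l := exist _ [tuple src q; tgt q; tgt r] cX.
  have -> : tri (src q) (tgt q) (tgt r) = gen X.
    by rewrite /tri -[ [tuple _; _; _] ]/(val X) valK.
  by apply: cutmap_gen; exists q, r; rewrite sqr.
rewrite tri_long // raddf0 cgen_Nbar //; apply: (Nbar_pcat h).
by case/nandP: lqr => ?; [left|right].
Qed.

Lemma tri_norm_lt q r : tgt q = src r -> (plen q + plen r < l)%N ->
  tri (src q) (tgt q) (tgt r) = 0.
Proof.
move=> e ll; rewrite /tri insubF // norm3.
have [n nq ->] := dist_path_ex q; rewrite e; have [m mr ->] := dist_path_ex r.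
by rewrite enatD; apply/negbTE/nandP; right; apply/eqP => /enat_inj; lia.
Qed.

(** Deleting an end vertex lowers the norm, so only the two middle faces
    remain. *)
Lemma boundary3_paths q r t (X : chain G 3 l) : tgt q = src r -> tgt r = src t ->
    (0 < plen q)%N -> (0 < plen t)%N -> (plen q + (plen r + plen t))%N = l ->
    val X = [tuple src q; tgt q; tgt r; tgt t] ->
  boundary (gen X : MC G K 3 l) =
    tri (src q) (tgt q) (tgt t) - tri (src q) (tgt r) (tgt t).
Proof.
move=> e1 e2 q0 t0 el eX; rewrite (boundary3 eX).
rewrite (_ : tri (tgt q) _ _ = 0); last first.
  by rewrite e1; apply: tri_norm_lt => //; lia.
rewrite (_ : tri (src q) (tgt q) (tgt r) = 0); last first.
  by apply: tri_norm_lt => //; lia.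
by rewrite sub0r subr0 addrC.
Qed.

(** The two middle faces of a quadruple are cuts of one path. *)
Lemma cutmap_boundary (b : MC G K 3 l) : cutmap (boundary b) = 0.
Proof.
apply: (freemod_ext (f := cutmap \o @boundary G K 2 l) (g := \0)) => X /=.
have [q [r [t [e1 e2 [q0 r0 t0] [el _] eX]]]] := chain3_paths X.
rewrite (boundary3_paths e1 e2 q0 t0 el eX) raddfB /=.
have [qr hqr] := pcat_ex e1; have [rt hrt] := pcat_ex e2.
have lrt := pcat_plen hrt; have lqr := pcat_plen hqr.
have [p hp] : exists p, pcat q rt = Some p.
  by apply: pcat_ex; rewrite e1 (pcat_src hrt).
have [P hP] : exists P : lpath G l, val P = p.
  by apply: lpathP; rewrite (pcat_plen hp) (pcat_plen hrt).
have hp' : pcat qr t = Some p by have := pcatA q r t; rewrite hrt hqr /= hp.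
have -> : cutmap (tri (src q) (tgt q) (tgt t)) = cgen K (pclass P).
  by rewrite -(pcat_tgt hrt); apply: cutmap_tri; rewrite ?hP //; lia.
have -> : cutmap (tri (src q) (tgt r) (tgt t)) = cgen K (pclass P).
  by rewrite -(pcat_tgt hqr) -(pcat_src hqr);
    apply: cutmap_tri; rewrite ?hP //; lia.
by rewrite subrr.
Qed.

Definition first_cut p : MC G K 2 l :=
  tri (src p) (head (src p) (val p).2) (tgt p).
Local Notation B := (@boundaries G K 2 l).

Lemma first_cutE q r p : pcat q r = Some p -> plen q = 1%N ->
  first_cut p = tri (src q) (tgt q) (tgt r).
Proof.
move=> h; rewrite /first_cut (pcat_tgt h); move/pcatE: h => [_ -> ->].
by rewrite /plen /tgt; case: (val q).2 => [|a []].
Qed.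

(** If all three pieces are shortest, this is the boundary of the quadruple.  A long
    middle piece spoils both cuts; a long outer piece spoils both cuts too, since
    it is contained in a piece of the other cut. *)
Lemma tri_cut q r t : tgt q = src r -> tgt r = src t ->
    (0 < plen q)%N -> (0 < plen r)%N -> (0 < plen t)%N ->
    (plen q + (plen r + plen t))%N = l ->
  tri (src q) (tgt q) (tgt t) - tri (src q) (tgt r) (tgt t) \in B.
Proof.
move=> e1 e2 q0 r0 t0 el.
have [qr hqr] := pcat_ex e1; have [rt hrt] := pcat_ex e2.
have lrt := pcat_plen hrt; have lqr := pcat_plen hqr.
have [/and3P [sq sr st]|lqrt] := boolP [&& shortest q, shortest r & shortest t].
  have cX : nondegenerate [tuple src q; tgt q; tgt r; tgt t] &&
      (norm [tuple src q; tgt q; tgt r; tgt t] == enat l).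
    rewrite nondeg4 norm4 (shortest_vertices sq) (shortest_dist sq).
    rewrite e1 (shortest_vertices sr) (shortest_dist sr).
    rewrite e2 (shortest_vertices st) (shortest_dist st).
    by rewrite -!lt0n q0 r0 t0 !enatD el eqxx.
  pose X : chain G 3 l := exist _ [tuple src q; tgt q; tgt r; tgt t] cX.
  by apply/asboolP; exists (gen X); apply: boundary3_paths.
have ert := pcat_tgt hrt; have eqr := pcat_tgt hqr; have esqr := pcat_src hqr.
rewrite -{1}ert tri_long ?(pcat_src hrt) //; try lia; last first.
  apply: contra lqrt => /andP [-> /(shortest_pcat hrt) [-> ->]] //.
rewrite -esqr -eqr tri_long ?eqr //; try lia.
  by rewrite subrr rpred0.
by apply: contra lqrt => /andP [/(shortest_pcat hqr) [-> ->] ->].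
Qed.

(** Splitting q after its first arrow gives three pieces, to which [tri_cut]
    applies. *)
Lemma first_cut_any q r p : pcat q r = Some p -> plen p = l ->
    (0 < plen q)%N -> (0 < plen r)%N ->
  first_cut p - tri (src q) (tgt q) (tgt r) \in B.
Proof.
move=> h pl q0 r0; have [a [b [hab a1]]] := pcat_split q0.
have lq := pcat_plen hab; have lp := pcat_plen h.
case: (posnP (plen b)) => [b0|b0].
  rewrite (first_cutE h) ?subrr ?rpred0 //; lia.
have [br hbr] : exists br, pcat b r = Some br.
  by apply: pcat_ex; rewrite -(pcat_tgt_src h) (pcat_tgt hab).
have hp : pcat a br = Some p by have := pcatA a b r; rewrite hab hbr /= h.
rewrite (first_cutE hp a1) (pcat_tgt hbr) (pcat_src hab) (pcat_tgt hab).
apply: tri_cut; rewrite ?a1 //; try lia.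
- exact: pcat_tgt_src hab.
- exact: pcat_tgt_src hbr.
Qed.

(** A move u s v -> u t v is invisible to a cut at the end of u, or at the
    start of v, and any cut represents the same element modulo boundaries. *)
Lemma first_cut_pclass (P Q : lpath G l) : pclass P = pclass Q ->
  first_cut (val P) - first_cut (val Q) \in B.
Proof.
move=> ePQ; apply/quot_eq.
apply: (pclass_ind (h := fun r => \pi_(quotmod B) (first_cut r))) ePQ.
move=> s t u v r r' ss st [e1 e2] est sl rl rl' hr hr'.
have lr := pcat3_plen hr.
case/pcat3E: (hr) => us [sv [h1 h2 h3 h4]].
case/pcat3E: (hr') => ut [tv [k1 k2 k3 k4]].
have lus := pcat_plen h1; have lut := pcat_plen k1.
have lsv := pcat_plen h2; have ltv := pcat_plen k2.
case: (posnP (plen s)) => [s0|s0].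
  have eq : s = t by apply: (plen1_eq _ est); rewrite ?s0.
  by have -> : r = r' by move: hr'; rewrite -eq hr => -[].
case: (posnP (plen u)) => [u0|u0].
  have v0 : (0 < plen v)%N by lia.
  (* cut at the end of s, which is also the end of t *)
  transitivity (\pi_(quotmod B) (tri (src us) (tgt us) (tgt v))).
    by apply/quot_eq; apply: first_cut_any => //; lia.
  have -> : src us = src ut by rewrite (pcat_src h1) (pcat_src k1).
  have -> : tgt us = tgt ut by rewrite (pcat_tgt h1) (pcat_tgt k1).
  by apply/esym/quot_eq; apply: first_cut_any => //; lia.
transitivity (\pi_(quotmod B) (tri (src u) (tgt u) (tgt sv))).
  by apply/quot_eq; apply: first_cut_any => //; lia.
have -> : tgt sv = tgt tv by rewrite (pcat_tgt h2) (pcat_tgt k2).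
by apply/esym/quot_eq; apply: first_cut_any => //; lia.
Qed.

(** A non-minimal long path has a cut with a long piece, which is zero. *)
Lemma first_cut_Nbar (P : lpath G l) : pclass P \in @Nbar G l ->
  first_cut (val P) \in B.
Proof.
move=> /NbarP [Q /nonminimal_ex [u [v [h huv]]] eQP].
have [u0 v0] : (0 < plen u)%N /\ (0 < plen v)%N.
  by case: huv => -[lg ?]; split=> //;
    rewrite ltnNge; apply: contra lg => ?; apply: shortest_plen1; lia.
have lQ := pcat_plen h; rewrite lpath_len in lQ.
rewrite -[first_cut _](subrK (first_cut (val Q))).
apply: rpredD; first exact: first_cut_pclass.
have := first_cut_any h (lpath_len Q) u0 v0; rewrite tri_long ?subr0 //.
  exact: pcat_tgt_src h.
by apply/nandP; case: huv => -[? _]; [left|right].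
Qed.

(** Inverse of [cutmap] modulo boundaries when l > 1. *)
Definition uncut : F -> MC G K 2 l :=
  lext (fun c : PNbar G l => first_cut (val (repr (val c)))).
HB.instance Definition _ := GRing.Linear.on uncut.

Lemma uncut_cutmap (m : MC G K 2 l) : uncut (cutmap m) - m \in B.
Proof.
pose f : {linear MC G K 2 l -> MC G K 2 l} := (uncut \o cutmap) \- idfun.
apply: (freemod_sub (f := f)) => X _; rewrite /f /=.
have [P cP] := cut_of_ex X; rewrite (cutmap_gen cP).
case: cP => q [r [h [q0 r0] sqr eX]].
have lP := pcat_plen h; rewrite lpath_len in lP.
have -> : gen X = tri (src q) (tgt q) (tgt r) by rewrite /tri -eX valK.
have hcut := first_cut_any h (lpath_len P) q0 r0.
have : uncut (cgen K (pclass P)) - first_cut (val P) \in B.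
  rewrite /uncut lext_cgen; case: insubP => [c _ /= ->|] /=.
    by apply: first_cut_pclass; rewrite pclass_repr_val.
  by rewrite negbK => /first_cut_Nbar hB; apply: submodB; rewrite ?rpred0.
by move=> h1; have := rpredD h1 hcut; rewrite addrA subrK.
Qed.

Lemma cutmap_uncut (u : F) : (1 < l)%N -> cutmap (uncut u) = u.
Proof.
move=> l1; apply: (freemod_ext (f := cutmap \o uncut) (g := idfun)) => c /=.
rewrite /uncut lext_gen; set P := repr (val c).
have [|q [r [h q1]]] := @pcat_split _ (val P) 1%N.
  by rewrite lpath_len; lia.
have lP := pcat_plen h; rewrite lpath_len in lP.
rewrite (first_cutE h q1) (cutmap_tri h) ?q1 //; last by lia.
by rewrite pclass_repr cgen_val.
Qed.

Definition MC1_ends : MC G K 1 l -> Ends :=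
  lext (fun X : chain G 1 l => gen (tnth (val X) ord0, tnth (val X) ord_max)).
HB.instance Definition _ := GRing.Linear.on MC1_ends.

Lemma MC1_ends_inj : injective MC1_ends.
Proof.
pose f : {linear Ends -> MC G K 1 l} := lext (fun xy => pair xy.1 xy.2).
apply: (can_inj (g := f)) => m.
apply: (freemod_ext (f := f \o MC1_ends) (g := idfun)) => X /=.
rewrite /MC1_ends lext_gen /f /= lext_gen /pair /=.
rewrite (_ : [tuple _; _] = val X) ?valK //.
exact: tuple2_eta.
Qed.

Lemma MC1_ends_pair x y : MC1_ends (pair x y) =
  if (x != y) && (dist x y == enat l) then gen (x, y) else 0.
Proof.
rewrite /MC1_ends /pair lext_ogen.
case: insubP => [X|]; rewrite nondeg2 norm2; last by move/negbTE->.
by move=> -> /= ->.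
Qed.

(** Of the three faces of (x, y, z) only (x, z) can survive, and it does exactly
    when the path cut at y is shortest. *)
Lemma endmap_cutmap m : endmap (cutmap m) = - MC1_ends (boundary m).
Proof.
apply: (freemod_ext (f := @endmap G K l \o cutmap)
                    (g := \- (MC1_ends \o @boundary G K 1 l))) => X /=.
have [P cP] := cut_of_ex X; rewrite (cutmap_gen cP) endmap_pclass.
case: cP => q [r [h [q0 r0] /andP [sq sr] eX]].
have lP := pcat_plen h; rewrite lpath_len in lP.
rewrite (boundary2 eX) raddfD raddfB /= !MC1_ends_pair.
rewrite [in dist (tgt q) _](pcat_tgt_src h) (shortest_dist sq)
  (shortest_dist sr).
rewrite [_ && (enat (plen r) == _)](_ : _ = false); last first.
  by apply/nandP; right; apply/eqP => /enat_inj; lia.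
rewrite [_ && (enat (plen q) == _)](_ : _ = false); last first.
  by apply/nandP; right; apply/eqP => /enat_inj; lia.
rewrite addr0 sub0r opprK -(pcat_src h) -(pcat_tgt h).
have [sP|lP'] := boolP (shortest (val P)).
  rewrite (shortest_vertices sP) (shortest_dist sP) lpath_len eqxx andbT.
  by rewrite ifT //; lia.
rewrite ifN //; apply/nandP; right; apply: contra lP'.
by rewrite /shortest lpath_len.
Qed.

Lemma MH_to_classes : exists A : {linear MH G K 2 l -> F}, injective A /\
  range A = (cutmap @` [set` @cycles G K 2 l])%classic.
Proof.
have [m _ /asboolP [b <-]|A [_ Ar Ai]] :=
  @subquot_lift _ _ _ (@cycles G K 2 l) B cutmap; first exact: cutmap_boundary.
exists A; split=> //; apply: Ai => m _ am.
have := uncut_cutmap m; rewrite am raddf0 sub0r => hm.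
by rewrite -[m]opprK -[- - m]sub0r; apply: submodB; rewrite ?rpred0.
Qed.

End Magnitude.

(** * Magnitude homology in terms of the generators *)

Section Comparison.
Variables (G : digraph) (K : comPzRingType) (l : nat).
Variable s : forall x y : G, dist x y == enat l -> lpath G l.
Hypothesis hs : forall (x y : G) (h : dist x y == enat l),
  src (val (s h)) = x /\ tgt (val (s h)) = y.

(** A path of length at most 1 is shortest and determined by its endpoints. *)
Lemma generator_length_gt1 (i : index1 s + index2 G l) : (1 < l)%N.
Proof.
rewrite ltnNge; apply/negP => l1; case: i => [c|c].
  case/eqP: (valP c); have [e1 e2] := hs (valP (val c)).
  rewrite -[LHS]pclass_repr; congr (pclass _); apply: val_inj.
  by apply: plen1_eq; rewrite ?lpath_len.
have /andP [/asboolP [p lp _] _] := valP c.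
by move: lp; rewrite /long shortest_plen1 ?lpath_len.
Qed.

Lemma cutmap_cycles_range :
  (@cutmap G K l @` [set` @cycles G K 2 l])%classic =
  range (lext (generator K s)).
Proof.
apply/seteqP; split=> [_ [m /eqP mc <-]|_ [u _ <-]].
  by apply/(endmap_ker hs); rewrite endmap_cutmap mc raddf0 oppr0.
have [l1|l1] := ltnP 1 l; last first.
  exists 0; first exact: rpred0.
  have -> : u = 0.
    apply: (freemod_ext (f := idfun) (g := \0)) => i.
    by have := generator_length_gt1 i; rewrite ltnNge l1.
  by rewrite !raddf0.
have du := (endmap_ker hs _).2 (imageT (lext (generator K s)) u).
exists (uncut (lext (generator K s) u)); last by rewrite cutmap_uncut.
have := endmap_cutmap (uncut (lext (generator K s) u)).
rewrite cutmap_uncut // du.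
move/eqP; rewrite eq_sym oppr_eq0 => /eqP e; apply/eqP/MC1_ends_inj.
by rewrite e raddf0.
Qed.
End Comparison.

Theorem theorem4p5 (G : digraph) (K : comPzRingType) (l : nat)
    (s : forall x y : G, dist x y == enat l -> lpath G l)
    (hs : forall (x y : G) (h : dist x y == enat l),
       src (val (s x y h)) = x /\ tgt (val (s x y h)) = y) :
  (exists f : {linear MH G K 2 l -> Rideal_mod G K l}, bijective f) /\
  exists Phi : {linear palg_mod G K l -> freemod K (PNbar G l)},
    [/\ bijective Phi,
        forall p : lpath G l,
          Phi (palg_mod_class K p) = cgen K (pclass p) &
        exists Psi : {linear Rideal_mod G K l -> freemod K (PNbar G l)},
          [/\ injective Psi,
              freely_generated (generator K s) (range Psi) &
              forall (v : palg G K)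
                (vR : v \in capS (Rideal G K) (homog l))
                (vG : v \in capS (fullS (palg G K)) (homog l)),
                Psi (sqclass (JRRJ G K) vR) = Phi (sqclass (JRRJ G K) vG)]].
Proof.
have [Phi [Phi_bij PhiE]] := palg_mod_to_classes G K l.
have [A [A_inj A_range]] := MH_to_classes G K l.
have [v _|Psi [PsiE Psi_range Psi_inj]] :=
    @subquot_lift _ _ _ (capS (Rideal G K) (homog l)) (JRRJ G K) (classmap l).
  exact: classmap_JRRJ.
have Psi_injective : injective Psi.
  by apply: Psi_inj => v /andP [_ vh]; apply: classmap_ker.
have range_Psi : range Psi = range (lext (generator K s)).
  by rewrite Psi_range; apply: classmap_R_range.
split.
  apply: (iso_of_eq_range A_inj Psi_injective).
  by rewrite A_range range_Psi; apply: cutmap_cycles_range.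
exists Phi; split=> [//|p|].
  by rewrite [LHS]PhiE classmap_gen lclass_val.
exists Psi; split; first exact: Psi_injective.
  by split; [apply: generator_injective|apply: range_Psi].
by move=> v vR vG; apply: etrans (PsiE v vR) (esym (PhiE v vG)).
Qed.
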